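(* Let $(\Omega,\mu)$ be a totally $\sigma$-finite measure space with a non-atomic measure $\mu$. Let $0<\theta<1$, $1<p_0<p_1<\infty$, $0<r,r_0,r_1,q_0\le\infty$, $b_0\in SV$, and $\left\|s^{-1/r_0}b_0(s)\right\|_{r_0,(1,\infty)}<\infty$. Put $c_0(t)=\left\|s^{-1/r_0}b_0(s)\right\|_{r_0,(t,\infty)}$ for $t>0$. Then $$\left(L^{(p_0,q_0,r_0)}_{b_0},L_{p_1,r_1}\right)_{\theta,r}\cong L_{p,r,a^{\#}},$$ where $\frac1p=\frac{1-\theta}{p_0}+\frac{\theta}{p_1}$ and $a^{\#}(t)=c_0(t)^{1-\theta}$. Here $L^{(p_0,q_0,r_0)}_{b_0}$ denotes the small Lorentz space.
   Context: All function spaces are over $(\Omega,\mu)$; $f^*$ denotes the non-increasing rearrangement of a $\mu$-measurable function $f$ on $\Omega$. $\|\cdot\|_{q,(c,d)}$ ($0<q\le\infty$) is the usual (quasi-)norm of the Lebesgue space $L_q$ on the interval $(c,d)$ with Lebesgue measure (variable of integration: the displayed variable; $1/\infty=0$). $SV$ is the set of positive Lebesgue measurable functions $b$ on $(0,\infty)$ that are slowly varying: for each $\varepsilon>0$, $t^{\varepsilon}b(t)$ is equivalent to an increasing function and $t^{-\varepsilon}b(t)$ is equivalent to a decreasing function, where two positive functions are equivalent if each is bounded by a constant multiple of the other. The Lorentz–Karamata space $L_{p,q,b}$ (also written $L_{p,q;b}$; $0<p,q\le\infty$, $b\in SV$) is the set of $\mu$-measurable $f$ with $\left\|t^{\frac1p-\frac1q}b(t)f^*(t)\right\|_{q,(0,\infty)}<\infty$;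 $L_{p,q}=L_{p,q,1}$ is the Lorentz space. The small Lorentz space $L^{(p,q,r)}_{b}$ ($0<p<\infty$, $0<q,r\le\infty$, $b\in SV$) is the set of $\mu$-measurable $f$ with $\left\|t^{-\frac1r}b(t)\left\|u^{\frac1p-\frac1q}f^*(u)\right\|_{q,(0,t)}\right\|_{r,(0,\infty)}<\infty$. For a compatible couple $(X_0,X_1)$ of (quasi-)Banach spaces, $(X_0,X_1)_{\theta,r}$ is the classical real interpolation space of $f\in X_0+X_1$ with $\left\|u^{-\theta-1/r}K(u,f)\right\|_{r,(0,\infty)}<\infty$, $K(u,f)=\inf\{\|f_0\|_{X_0}+u\|f_1\|_{X_1}: f=f_0+f_1,\ f_i\in X_i\}$. $X\cong Y$ means that $X$ and $Y$ are continuously embedded in each other (same space, equivalent quasi-norms). *)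

(* Defs.v *)
From HB Require Import structures.
From mathcomp Require Import all_boot all_order all_algebra.
From mathcomp Require Import all_classical all_reals all_analysis.

Set Implicit Arguments.
Unset Strict Implicit.
Unset Printing Implicit Defensive.

Import Order.TTheory GRing.Theory Num.Theory.
Import numFieldNormedType.Exports.

Local Open Scope classical_set_scope.
Local Open Scope ring_scope.

Section Scalars.
Context {R : realType}.
Implicit Types (p q r : \bar R) (b f g : R -> R).

(* 1/q as a real number for 0 < q <= +oo; the library inverse on [\bar R]
   satisfies [+oo^-1 = 0]. *)
Definition rinv q : R := fine (q^-1)%E.

(* The L_q (quasi-)norm, 0 < q <= +oo, of g on the interval A. The library
   restriction [g \_ A] vanishes outside A. The completed measure is defined on
   the Lebesgue sigma-algebra, [lebesgue_measure] only on the Borel one. *)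
Definition Lq_norm q (A : set R) (g : R -> \bar R) : \bar R :=
  'N[@completed_lebesgue_measure R]_q[g \_ A]%E.

Definition positive_on g := forall t, 0 < t -> 0 < g t.

Definition equivalent f g := exists2 C : R, 0 < C &
  forall t, 0 < t -> f t <= C * g t /\ g t <= C * f t.

(* "Increasing" and "decreasing" are meant in the non-strict sense. *)
Definition increasing_on g := forall s t, 0 < s -> s <= t -> g s <= g t.
Definition decreasing_on g := forall s t, 0 < s -> s <= t -> g t <= g s.

Definition lebesgue_measurable_fun (A : set R) g :=
  @measurable_fun _ _ (caratheodory_type (@wlength R idfun)^*%mu)
    (measurableTypeR R) A g.

(* Functions on (0, +oo) are represented by total functions on R, of which only
   the values at positive arguments matter. *)
Definition SV b := [/\ lebesgue_measurable_fun `]0, +oo[ b,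
  positive_on b &
  forall e : R, 0 < e ->
    (exists g, [/\ positive_on g, increasing_on g &
                   equivalent (fun t => t `^ e * b t) g]) /\
    (exists g, [/\ positive_on g, decreasing_on g &
                   equivalent (fun t => t `^ (- e) * b t) g])].

(* t |-> || s^(-1/r) b(s) ||_{r, (t, +oo)} *)
Definition tail_norm r b (t : R) : \bar R :=
  Lq_norm r `]t, +oo[ (fun s => (s `^ (- rinv r) * b s)%:E).

End Scalars.

Section Spaces.
Context {d : measure_display} {T : measurableType d} {R : realType}.

Definition nonatomic (mu : {measure set T -> \bar R}) :=
  forall A, measurable A -> (0 < mu A)%E ->
    exists B, [/\ measurable B, B `<=` A & (0 < mu B < mu A)%E].

(* A (quasi-)normed space of functions on T, with functions standing for their
   classes modulo almost everywhere equality. *)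
Record fspace := FSpace {
  fcarrier : set (T -> R);
  fnorm : (T -> R) -> \bar R }.

Implicit Types (mu : {measure set T -> \bar R}) (f : T -> R) (X Y : fspace).

Definition embedded X Y := fcarrier X `<=` fcarrier Y /\
  exists2 C : R, 0 < C &
    forall f, fcarrier X f -> (fnorm Y f <= C%:E * fnorm X f)%E.

Definition cong_spaces X Y := embedded X Y /\ embedded Y X.

(* The non-increasing rearrangement f^*. *)
Definition rearr mu f (t : R) : \bar R :=
  ereal_inf [set l%:E | l in
    [set l : R | 0 <= l /\ (mu [set x | (l < `|f x|)%R] <= t%:E)%E]].

Definition space_of_norm (N : (T -> R) -> \bar R) : fspace :=
  FSpace [set f | measurable_fun setT f /\ (N f < +oo)%E] N.

Definition lorentz_karamata_norm mu (p q : \bar R) (b : R -> R) f : \bar R :=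
  Lq_norm q `]0, +oo[
    (fun t => (t `^ (rinv p - rinv q) * b t)%:E * rearr mu f t)%E.

Definition lorentz_karamata mu p q b : fspace :=
  space_of_norm (lorentz_karamata_norm mu p q b).

Definition lorentz mu p q : fspace := lorentz_karamata mu p q (fun=> 1).

Definition small_lorentz_norm mu (p q r : \bar R) (b : R -> R) f : \bar R :=
  Lq_norm r `]0, +oo[ (fun t => (t `^ (- rinv r) * b t)%:E *
    Lq_norm q `]0%R, t[
      (fun u => (u `^ (rinv p - rinv q))%:E * rearr mu f u))%E.

Definition small_lorentz mu p q r b : fspace :=
  space_of_norm (small_lorentz_norm mu p q r b).

Definition decomposition mu X0 X1 f (f01 : (T -> R) * (T -> R)) :=
  [/\ fcarrier X0 f01.1, fcarrier X1 f01.2 &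
      {ae mu, forall x, f x = f01.1 x + f01.2 x}].

Definition Kfun mu X0 X1 (u : R) f : \bar R :=
  ereal_inf [set (fnorm X0 f01.1 + u%:E * fnorm X1 f01.2)%E |
    f01 in decomposition mu X0 X1 f].

Definition real_interp_norm mu X0 X1 (theta : R) (r : \bar R) f : \bar R :=
  Lq_norm r `]0, +oo[
    (fun u => (u `^ (- theta - rinv r))%:E * Kfun mu X0 X1 u f)%E.

(* f ranges over the sum X0 + X1, the existence of a decomposition. *)
Definition real_interp mu X0 X1 theta r : fspace :=
  FSpace [set f | [/\ measurable_fun setT f,
                      exists f01, decomposition mu X0 X1 f f01 &
                      (real_interp_norm mu X0 X1 theta r f < +oo)%E]]
         (real_interp_norm mu X0 X1 theta r).

End Spaces.

(* Main.v *)
(* Write c(t) for the tail norm of b_0 and u(t) = t^(1/p_0 - 1/p_1) c(t), which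
   is equivalent to an increasing function of power growth. Up to constants,
   f^*(t) t^(1/p_0) c(t) is at most the small Lorentz norm of f, and
   f^*(t) t^(1/p_1) at most its norm in L_{p_1, r_1}; with
   f^*(2t) <= f_0^*(t) + f_1^*(t) this gives t^(1/p_0) c(t) f^*(2t) <= C K(u(t), f). Conversely, cutting f at the
   level f^*(s) bounds u(s)^(-theta) K(u(s), f) by a multiple of
   sup_v min(s/v, v/s)^eta v^(1/p) c(v)^(1 - theta) f^*(v) for a small eta > 0:
   if f^* lies below the corresponding explicit envelope, both norms are computed
   from power integrals. In each direction the two norms to be compared are split
   along s_k = l^k and u_k = u(s_k) with a ratio l so large that u_(k+1) >= 2 u_k,
   so that only sequences in l^r(Z) remain; the supremum costs a geometric
   factor, which is harmless for every 0 < r <= oo. *)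
Require Import Defs.
From HB Require Import structures.
From mathcomp Require Import all_boot all_order all_algebra.
From mathcomp Require Import all_classical all_reals all_analysis.
From mathcomp Require Import measurable_realfun ess_sup_inf ring lra zify.

Set Implicit Arguments.
Unset Strict Implicit.
Unset Printing Implicit Defensive.

Import Order.TTheory GRing.Theory Num.Theory.
Import numFieldNormedType.Exports.

Local Open Scope classical_set_scope.
Local Open Scope ring_scope.
Local Open Scope ereal_scope.

(** * The quasi-norms on intervals *)

(** The substitution [u = U(t)] is out of reach, since U (the function [balance]) is known to be
    monotone only up to a constant. Sampling along [s_k] replaces it: the points [U(s_k)] only have
    to grow at least by the factor 2 and at most by a fixed ratio to cut the half-line into pieces
    on which power weights are nearly constant. The growth of U comes from the slow variation of c:
    between s and t > s it loses at most a factor [C (t/s)^e] for every e > 0, and e is taken to be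
    half of [1/p_0 - 1/p_1]. The target weight [t^(1/p) c^(1-theta)] has two factorisations,
    [U^(-theta) t^(1/p_0) c] and [U^(1-theta) t^(1/p_1)]; the first matches the small Lorentz norm
    to the left of the cut, the second the Lorentz norm to the right. The left envelope carries a
    factor [1/c(v)], which is what makes the small Lorentz norm computable: on (0, s) it is
    cancelled by [b_0 <= K c], and beyond s the inner norm is constant, so that the outer norm is
    the tail [c(s)] itself. *)

Section LqNorm.
Context {R : realType}.
Implicit Types (q : \bar R) (A B : set R) (g h : R -> \bar R).

Local Notation mR := (caratheodory_type (@wlength R idfun)^*%mu).
Local Notation leb := (@completed_lebesgue_measure R).

Definition leb_measurable A := @measurable _ mR A.
Definition eleb_measurable A g := @measurable_fun _ _ mR (\bar R) A g.

Lemma measurable_leb A : @measurable _ (measurableTypeR R) A -> leb_measurable A.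
Proof. by move=> mA; apply: sub_caratheodory. Qed.

Lemma leb_measurable_itv (i : interval R) : leb_measurable [set` i].
Proof. by apply: measurable_leb; exact: measurable_itv. Qed.

Lemma leb_itv (a b : R) x y : (a <= b)%R ->
  leb [set` Interval (BSide x a) (BSide y b)] = (b - a)%:E.
Proof.
move=> ab; transitivity (@lebesgue_measure R [set` Interval (BSide x a) (BSide y b)]).
  by [].
by rewrite lebesgue_measure_itv /= lte_fin; case: ltgtP ab => // ->; rewrite subrr.
Qed.

(** The library norm with exponent +oo is the essential supremum only on a space of positive
    measure. *)
Lemma leb_setT_gt0 : 0 < leb setT.
Proof.
apply: (@lt_le_trans _ _ (leb `[0%R, 1%R])).
  by rewrite leb_itv // subr0 lte_fin.
by apply: le_measure; rewrite ?inE //; exact: leb_measurable_itv.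
Qed.

Lemma Lq_normE_fin (q : R) A g : (0 < q)%R ->
  Lq_norm q%:E A g = (\int[leb]_x (`|(g \_ A) x| `^ q)) `^ q^-1.
Proof. by move=> _; rewrite /Lq_norm unlock. Qed.

Lemma Lq_normE_oo A g : Lq_norm +oo A g = ess_sup leb (abse \o (g \_ A)).
Proof. by rewrite /Lq_norm unlock leb_setT_gt0. Qed.

(** The integral of a nonnegative function is a supremum over the simple functions below it, so
    monotonicity needs no measurability. This keeps the comparison lemmas for [Lq_norm] free of such
    hypotheses. *)
Lemma le_integral_nonneg g h : (forall x, 0 <= g x <= h x) ->
  \int[leb]_x g x <= \int[leb]_x h x.
Proof.
move=> gh.
have g0 x : 0 <= g x by case/andP: (gh x).
have h0 x : 0 <= h x by case/andP: (gh x) => /le_trans; apply.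
rewrite !ge0_integralTE //.
apply: le_ereal_sup => _ [k kg <-]; exists k => // x.
by case/andP: (gh x) => _; apply: le_trans.
Qed.

Lemma le_poweR (x y : \bar R) (p : R) : (0 <= p)%R -> 0 <= x -> x <= y ->
  x `^ p <= y `^ p.
Proof.
move=> p0 x0 xy; apply: gt0_ler_poweR => //.
  by rewrite in_itv /= leey x0.
by rewrite in_itv /= leey (le_trans x0).
Qed.

(** Comparing the extensions by zero also covers a set [A] larger than [B], when [g] vanishes on the
    difference. *)
Lemma Lq_norm_patch_le q A B g h : 0 < q ->
  (forall x, 0 <= (g \_ A) x <= (h \_ B) x) -> Lq_norm q A g <= Lq_norm q B h.
Proof.
move=> q0 gh.
have gh' x : `|(g \_ A) x| <= `|(h \_ B) x|.
  by case/andP: (gh x) => g0 gle; rewrite !gee0_abs // (le_trans g0).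
case: q q0 => [q|_|//]; last first.
  by rewrite !Lq_normE_oo; apply: le_ess_sup; apply: nearW.
rewrite lte_fin => q0; rewrite !Lq_normE_fin //.
apply: le_poweR; first by rewrite invr_ge0 ltW.
  by apply: integral_ge0 => x _; exact: poweR_ge0.
apply: le_integral_nonneg => x; rewrite poweR_ge0 /=.
by apply: le_poweR => //; exact: ltW.
Qed.

Lemma Lq_norm_le q A B g h : 0 < q -> A `<=` B ->
  (forall x, A x -> 0 <= g x <= h x) -> (forall x, B x -> 0 <= h x) ->
  Lq_norm q A g <= Lq_norm q B h.
Proof.
move=> q0 AB gh h0; apply: Lq_norm_patch_le => // x; rewrite /patch.
case: ifPn; rewrite ?inE ?notin_setE => Ax.
  by rewrite ifT ?inE; [exact: gh|exact: AB].
by rewrite lexx /=; case: ifPn; rewrite ?inE // => /h0.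
Qed.

Lemma Lq_norm_ge0 q A g : 0 < q -> 0 <= Lq_norm q A g.
Proof.
case: q => [q|_|//]; first by rewrite lte_fin => q0; rewrite Lq_normE_fin // poweR_ge0.
rewrite Lq_normE_oo; apply: ess_sup_gee; first exact: leb_setT_gt0.
by apply: nearW => x /=; exact: abse_ge0.
Qed.

End LqNorm.

(** * Sequence norms over the integers and countable partitions *)

Section ell.
Context {R : realType}.
Implicit Types (q : \bar R) (A B : set R) (g h : R -> \bar R).
Implicit Types (y z : int -> \bar R).

Local Notation mR := (caratheodory_type (@wlength R idfun)^*%mu).
Local Notation leb := (@completed_lebesgue_measure R).

(** The quasi-norm of l^q(Z) for nonnegative sequences, which is why no absolute value appears. *)
Definition ell q y : \bar R :=
  match q with
  | q%:E => (\esum_(k in [set: int]) (y k `^ q)) `^ q^-1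
  | _ => ereal_sup (range y)
  end.

Lemma poweRK (x : \bar R) (q : R) : (0 < q)%R -> 0 <= x -> (x `^ q^-1) `^ q = x.
Proof. by move=> q0 x0; rewrite -poweRrM mulVf ?gt_eqF // poweRe1. Qed.

Lemma poweRVK (x : \bar R) (q : R) : (0 < q)%R -> 0 <= x -> (x `^ q) `^ q^-1 = x.
Proof. by move=> q0 x0; rewrite -poweRrM mulfV ?gt_eqF // poweRe1. Qed.

(** The order 0, -1, 1, -2, 2, ...; it transfers countable additivity from sequences indexed by
    [nat]. *)
Definition int_enum (n : nat) : int := if odd n then Negz n./2 else Posz n./2.
Local Notation e := int_enum.
Let e' (k : int) : nat := match k with Posz m => m.*2 | Negz m => m.*2.+1 end.
Let eK : cancel e e'.
Proof.
move=> n; rewrite /int_enum /e'; case: ifP => o.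
  by rewrite -[RHS]odd_double_half o.
by rewrite -[RHS]odd_double_half o.
Qed.
Let eK' : cancel e' e.
Proof.
case=> m; rewrite /int_enum /e' /=; first by rewrite odd_double doubleK.
by rewrite odd_double /= uphalf_double.
Qed.
Lemma int_enum_bij : set_bij [set: nat] [set: int] e.
Proof.
split => //; first by move=> x y _ _; exact: (can_inj eK).
by move=> k _; exists (e' k) => //; exact: eK'.
Qed.

Lemma esum_int (a : int -> \bar R) : (forall k, 0 <= a k) ->
  \esum_(k in [set: int]) a k = \sum_(n <oo) a (e n).
Proof.
by move=> a0; rewrite (reindex_esum _ _ _ _ int_enum_bij) -nneseries_esumT.
Qed.

Lemma Lq_norm_fin_pow (q : R) A g : (0 < q)%R -> leb_measurable A ->
  (Lq_norm q%:E A g) `^ q = \int[leb]_(x in A) (`|g x| `^ q).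
Proof.
move=> q0 mA; rewrite Lq_normE_fin // poweRK //; last first.
  by apply: integral_ge0 => *; exact: poweR_ge0.
rewrite [RHS]integral_mkcond; apply: eq_integral => x _.
rewrite /patch; case: ifP => // _.
by rewrite abse0 poweR0r // gt_eqF.
Qed.

Lemma measurable_fun_abse_poweR (q : R) A g : leb_measurable A ->
  eleb_measurable A g -> eleb_measurable A (fun x => `|g x| `^ q).
Proof.
move=> mA mg; apply: (@measurableT_comp _ _ _ _ _ _ (fun x : \bar R => x `^ q)).
  exact: measurable_poweR.
by apply: measurableT_comp.
Qed.

(** For finite q this is countable additivity of the integral of the q-th power; for q = +oo, a
    countable union of null sets is null. *)
Lemma Lq_norm_bigcup q (F : int -> set R) g : 0 < q ->
  (forall k, leb_measurable (F k)) -> trivIset setT F ->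
  eleb_measurable (\bigcup_k F k) g ->
  Lq_norm q (\bigcup_k F k) g = ell q (fun k => Lq_norm q (F k) g).
Proof.
move=> q0 mF tF mg; case: q q0 => [q|_|//].
  rewrite lte_fin => q0 /=.
  have mUF : leb_measurable (\bigcup_k F k).
    rewrite (_ : \bigcup_k F k = \bigcup_n F (e n)).
      by apply: bigcupT_measurable => n; exact: mF.
    apply/seteqP; split=> x [k _ Fx]; last by exists (e k).
    by exists (e' k) => //; rewrite eK'.
  rewrite -[LHS](@poweRVK _ q) ?Lq_norm_ge0 //.
  congr (_ `^ _).
  rewrite Lq_norm_fin_pow //.
  under eq_esum do rewrite Lq_norm_fin_pow //.
  rewrite esum_int; last first.
    by move=> n; apply: integral_ge0 => *; exact: poweR_ge0.
  have UE : \bigcup_k F k = \bigcup_n F (e n).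
    apply/seteqP; split=> x [k _ Fx]; last by exists (e k).
    by exists (e' k) => //; rewrite eK'.
  have mgq : eleb_measurable (\bigcup_n F (e n)) (fun x => `|g x| `^ q).
    by rewrite -UE; exact: measurable_fun_abse_poweR.
  rewrite UE ge0_integral_bigcup //.
  - by move=> n; exact: mF.
  - by move=> *; exact: poweR_ge0.
  - move=> i j _ _ /= ij; apply: (can_inj eK); exact: tF.
rewrite /= Lq_normE_oo; apply/eqP; rewrite eq_le; apply/andP; split.
  apply/ess_supP.
  have : (\forall x \ae leb, (forall n, `|(g \_ (F (e n))) x| <= Lq_norm +oo (F (e n)) g)).
    apply/ae_foralln => n; rewrite Lq_normE_oo.
    exact: (@ess_sup_ge _ _ _ leb (abse \o (g \_ (F (e n))))).
  apply: (@filterS _ _ (ae_filter_ringOfSetsType leb)) => x Hx /=.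
  have sup0 n : Lq_norm +oo (F (e n)) g <=
      ereal_sup (range (fun k => Lq_norm +oo (F k) g)).
    by apply: ereal_sup_ubound; exists (e n).
  rewrite /patch; case: ifPn; rewrite ?inE.
    move=> [k _ Fkx]; apply: le_trans (sup0 (e' k)).
    have := Hx (e' k); rewrite eK' /patch ifT //.
    by rewrite inE.
  move=> _; rewrite abse0; apply: le_trans (sup0 0%N).
  exact: Lq_norm_ge0.
apply: ge_ereal_sup => _ [k _ <-]; rewrite Lq_normE_oo.
apply: le_ess_sup; apply: nearW => x /=; rewrite /patch.
case: ifPn => [|_]; last by rewrite abse0 abse_ge0.
by rewrite inE => Fx; rewrite ifT // inE; exists k.
Qed.

End ell.

(** * A discrete Hardy inequality *)

Section ell_geom.
Context {R : realType}.
Implicit Types (q : \bar R) (y z : int -> \bar R).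

Lemma esum_intZl (c : R) (a : int -> \bar R) : (0 <= c)%R -> (forall k, 0 <= a k) ->
  \esum_(k in [set: int]) (c%:E * a k) = c%:E * \esum_(k in [set: int]) a k.
Proof.
move=> c0 a0; rewrite !esum_int //; last by move=> k; rewrite mule_ge0.
by rewrite nneseriesZl.
Qed.

Lemma esum_int_shift (m : int) (a : int -> \bar R) :
  \esum_(k in [set: int]) a (k + m)%R = \esum_(k in [set: int]) a k.
Proof.
rewrite [RHS](reindex_esum setT setT (fun k => k + m)%R) //.
split => //; first by move=> x y _ _; exact: addIr.
by move=> k _; exists (k - m)%R => //; rewrite subrK.
Qed.

Lemma esum_int_swap (a : int -> int -> \bar R) : (forall i j, 0 <= a i j) ->
  \esum_(i in [set: int]) \esum_(j in [set: int]) a i j =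
  \esum_(j in [set: int]) \esum_(i in [set: int]) a i j.
Proof.
move=> a0; rewrite !esum_esum //.
rewrite (reindex_esum (setT `*`` (fun=> setT)) (setT `*`` (fun=> setT))
  (fun p : int * int => (p.2, p.1))) //.
split => //; first by move=> [x1 x2] [y1 y2] _ _ /= [-> ->].
by move=> [x1 x2] _; exists (x2, x1).
Qed.

Lemma esum_int_geometric_lty (v : R) : (0 < v < 1)%R ->
  \esum_(m in [set: int]) ((v ^+ absz m)%:E) < +oo.
Proof.
move=> /andP[v0 v1]; rewrite esum_int; last first.
  by move=> k; rewrite lee_fin exprn_ge0 ?ltW.
pose s := Num.sqrt v.
have s0 : (0 < s)%R by rewrite sqrtr_gt0.
have s1 : (s < 1)%R by rewrite -sqrtr1 ltr_sqrt.
have vs : v = (s ^+ 2)%R by rewrite sqr_sqrtr // ltW.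
apply: (@le_lt_trans _ _ (\sum_(n <oo) (geometric s^-1 s n)%:E)).
  apply: lee_nneseries => n _; first by rewrite lee_fin exprn_ge0 ?ltW.
  rewrite lee_fin /geometric /= vs -exprM -(ler_pM2l s0) mulVKf ?gt_eqF // -exprS.
  rewrite ler_wiXn2l ?ltW //.
  rewrite /int_enum; case: ifP => o; rewrite -[X in (X <= _)%N]odd_double_half o; lia.
have cg : series (geometric s^-1 s) @ \oo --> (s^-1 / (1 - s))%R.
  by apply: cvg_geometric_series; rewrite ger0_norm ?ltW.
have -> : \sum_(n <oo) (geometric s^-1 s n)%:E = (s^-1 / (1 - s))%:E.
  apply/cvg_lim => //.
  rewrite (_ : (fun n => _) = EFin \o series (geometric s^-1 s)).
    by apply: cvg_EFin => //; exact: nearW.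
  by apply/funext => n /=; rewrite sumEFin.
by rewrite ltry.
Qed.

(* The hypothesis says [y k <= C * sup_j (w ^ - |j - k| * z j)]. The q-th power
   of this supremum is at most the sum of the q-th powers, so that the claim for
   finite q is the boundedness of a convolution with a summable sequence; no
   convexity is used, whence the range [0 < q]. *)
Lemma ell_geom q (w C : R) : 0 < q -> (1 < w)%R -> (0 <= C)%R ->
  exists2 C' : R, (0 < C')%R & forall y z,
    (forall k, 0 <= y k) -> (forall k, 0 <= z k) ->
    (forall k (B : R), (0 <= B)%R ->
      (forall j, z j <= (w ^+ absz (j - k)%R * B)%:E) -> y k <= (C * B)%:E) ->
    ell q y <= C'%:E * ell q z.
Proof.
move=> q0 w1 C0; have w0 : (0 < w)%R by rewrite (lt_trans ltr01).
case: q q0 => [q|_|//]; last first.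
  exists (C + 1)%R => [|y z y0 z0 H]; first by rewrite ltr_wpDl.
  have [->|zy] := eqVneq (ell +oo z) +oo.
    by rewrite gt0_muley ?leey // lte_fin ltr_wpDl.
  have zs j : z j <= ell +oo z by apply: ereal_sup_ubound; exists j.
  have ellz0 : 0 <= ell +oo z by apply: le_trans (z0 0%R) (zs _).
  have : ell +oo z \is a fin_num by rewrite ge0_fin_numE // ltey.
  case E : (ell +oo z) => [B| |] // _.
  have B0 : (0 <= B)%R by rewrite -lee_fin -E.
  apply: ge_ereal_sup => _ [k _ <-].
  apply: le_trans (H k B B0 _) _.
    move=> j; rewrite (le_trans (zs j)) // E lee_fin ler_peMl // exprn_ege1 //.
    exact: ltW.
  by rewrite -EFinM lee_fin ler_wpM2r // lerDl.
rewrite lte_fin => q0.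
pose v := (w `^ (- q))%R.
have v0 : (0 < v)%R by rewrite powR_gt0.
have v1 : (v < 1)%R.
  rewrite /v powRN invf_lt1 ?powR_gt0 //.
  have := @gt0_ltr_powR _ q q0 1%R w; rewrite powR1; apply=> //; rewrite nnegrE; exact: ltW.
have W : \esum_(m in [set: int]) ((v ^+ absz m)%:E) < +oo.
  by apply: esum_int_geometric_lty; rewrite v0.
have W0 : 0 <= \esum_(m in [set: int]) ((v ^+ absz m)%:E).
  by apply: esum_ge0 => m _; rewrite lee_fin exprn_ge0 // ltW.
have : \esum_(m in [set: int]) ((v ^+ absz m)%:E) \is a fin_num by rewrite ge0_fin_numE.
case EW : (\esum_(m in [set: int]) _) W W0 => [S| |] // _ S0 _.
rewrite lee_fin in S0.
(* [S] is the mass of the kernel [v^|m|] that remains after taking q-th powers; the added units make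
   positivity immediate. *)
exists ((C + 1) * (S + 1) `^ q^-1)%R => [|y z y0 z0 H].
  by rewrite mulr_gt0 ?powR_gt0 // ltr_wpDl.
have D0 : (0 < (C + 1) * (S + 1) `^ q^-1)%R.
  by rewrite mulr_gt0 ?powR_gt0 // ltr_wpDl.
have [->|zy] := eqVneq (ell q%:E z) +oo.
  by rewrite gt0_muley ?leey // lte_fin.
pose Z := \esum_(k in [set: int]) (z k `^ q).
have Z0 : 0 <= Z by apply: esum_ge0 => *; exact: poweR_ge0.
have Zfin : Z < +oo.
  rewrite ltey; apply: contra_neq zy => /= Zy.
  by rewrite -/Z Zy poweRyr // invr_neq0 // gt_eqF.
pose T k := \esum_(m in [set: int]) ((v ^+ absz m)%:E * z (k + m)%R `^ q).
have T0 k : 0 <= T k.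
  by apply: esum_ge0 => m _; rewrite mule_ge0 ?poweR_ge0 // lee_fin exprn_ge0 ?ltW.
have TZ k : T k <= Z.
  rewrite /Z -(esum_int_shift k); apply: le_esum => m _.
  rewrite addrC -[leRHS]mul1e lee_wpmul2r ?poweR_ge0 // lee_fin exprn_ile1 ?ltW //.
have yT k : y k `^ q <= (((C + 1) `^ q)%R)%:E * T k.
  have Tfin : T k \is a fin_num by rewrite ge0_fin_numE // (le_lt_trans (TZ k)).
  (* The term m = j - k alone of the sum [T k] bounds [z j], so the q-th root of [T k] is admissible
     in the hypothesis at [k]. *)
  pose B := fine (T k `^ q^-1).
  have EB : B%:E = T k `^ q^-1 by rewrite fineK // fin_num_poweR.
  have B0 : (0 <= B)%R by rewrite -lee_fin EB poweR_ge0.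
  have zB j : z j <= (w ^+ absz (j - k)%R * B)%:E.
    have a0 : 0 <= (w ^+ absz (j - k)%R * B)%:E.
      by rewrite lee_fin mulr_ge0 // exprn_ge0 // ltW.
    rewrite -(poweRVK q0 (z0 j)) -(poweRVK q0 a0); apply: le_poweR.
    - by rewrite invr_ge0 ltW.
    - exact: poweR_ge0.
    rewrite EFinM poweRM ?lee_fin // ?exprn_ge0 ?(ltW w0) // EB poweRK //.
    rewrite poweR_EFin -powR_mulrn ?(ltW w0) // -powRrM mulrC powRrM powR_mulrn ?powR_ge0 //.
    have vw : (w `^ q * v = 1)%R by rewrite /v powRN mulfV // gt_eqF // powR_gt0.
    have : (v ^+ absz (j - k)%R)%:E * z j `^ q <= T k.
      apply: esum_ge; exists [set (j - k)%R].
        by split => //; exact: finite_set1.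
      by rewrite fsbig_set1 (addrC k) subrK.
    move=> /(lee_wpmul2l (x := ((w `^ q) ^+ absz (j - k)%R)%:E)).
    rewrite lee_fin exprn_ge0 ?powR_ge0 // => /(_ isT).
    by rewrite muleA -EFinM -exprMn vw expr1n mul1e.
  have := H k B B0 zB => yB.
  apply: (@le_trans _ _ (((C + 1) * B)%:E `^ q)).
    apply: le_poweR => //; first exact: ltW.
    by apply: le_trans yB _; rewrite lee_fin ler_wpM2r // lerDl.
  rewrite EFinM poweRM ?lee_fin ?addr_ge0 // EB poweRK // poweR_EFin.
have sT : \esum_(k in [set: int]) T k = S%:E * Z.
  rewrite /T esum_int_swap; last first.
    by move=> *; rewrite mule_ge0 ?poweR_ge0 // lee_fin exprn_ge0 ?ltW.
  under eq_esum => j _.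
    rewrite esum_intZl ?exprn_ge0 ?ltW //; last by move=> *; exact: poweR_ge0.
    rewrite (esum_int_shift j (fun k => z k `^ q)) -/Z muleC.
    over.
  have ZE : Z = (fine Z)%:E by rewrite fineK // ge0_fin_numE.
  rewrite ZE esum_intZl ?fine_ge0 //; last first.
    by move=> k; rewrite lee_fin exprn_ge0 ?ltW.
  by rewrite EW muleC.
rewrite /= -/Z.
apply: (@le_trans _ _ (((((C + 1) `^ q)%R)%:E * ((S + 1)%:E * Z)) `^ q^-1)).
  apply: le_poweR.
  - by rewrite invr_ge0 ltW.
  - by apply: esum_ge0 => *; exact: poweR_ge0.
  apply: (@le_trans _ _ (\esum_(k in [set: int]) ((((C + 1) `^ q)%R)%:E * T k))).
    by apply: le_esum => k _; exact: yT.
  rewrite esum_intZl ?powR_ge0 // lee_wpmul2l ?lee_fin ?powR_ge0 // sT.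
  by rewrite lee_wpmul2r // lee_fin lerDl.
rewrite !poweRM ?mule_ge0 ?lee_fin ?powR_ge0 ?addr_ge0 //.
rewrite -(poweR_EFin (C + 1)) poweRVK ?lee_fin ?addr_ge0 // poweR_EFin muleA -EFinM.
exact: lexx.
Qed.

End ell_geom.

(** * Power weights on one interval of bounded ratio *)

Section pieces.
Context {R : realType}.
Implicit Types (q : \bar R) (A B : set R) (g h : R -> \bar R).

Local Notation mR := (caratheodory_type (@wlength R idfun)^*%mu).
Local Notation leb := (@completed_lebesgue_measure R).

(** Superlevel sets of a monotone function are intervals. Measurability of powers, of f^*, of K and
    of the tail norm is obtained in this way. *)
Lemma nondecreasing_eleb_measurable g :
  (forall s t, (0 < s)%R -> (s <= t)%R -> g s <= g t) ->
  eleb_measurable `]0%R, +oo[ g.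
Proof.
move=> g_nd mD; apply: (measurability _ (ErealGenCInfty.measurableE R)) => //.
move=> _ [_ [r ->] <-]; apply: measurable_leb.
apply: is_interval_measurable => s t /= [].
rewrite !in_itv /= !andbT => s0 gs [t0 gt] u /andP[su ut].
split; rewrite in_itv /= andbT ?(lt_le_trans s0) //.
by rewrite (le_trans gs) // g_nd.
Qed.

Lemma nonincreasing_eleb_measurable g :
  (forall s t, (0 < s)%R -> (s <= t)%R -> g t <= g s) ->
  eleb_measurable `]0%R, +oo[ g.
Proof.
move=> g_ni mD; apply: (measurability _ (ErealGenCInfty.measurableE R)) => //.
move=> _ [_ [r ->] <-]; apply: measurable_leb.
apply: is_interval_measurable => s t /= [].
rewrite !in_itv /= !andbT => s0 gs [t0 gt] u /andP[su ut].
split; rewrite in_itv /= andbT ?(lt_le_trans s0) //.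
by rewrite (le_trans gt) // g_ni // (lt_le_trans s0).
Qed.

Lemma powR_eleb_measurable (a : R) :
  eleb_measurable `]0%R, +oo[ (fun t => (t `^ a)%:E).
Proof.
have [a0|a0] := leP 0%R a.
  apply: nondecreasing_eleb_measurable => s t s0 st.
  by rewrite lee_fin ge0_ler_powR // nnegrE ltW // (lt_le_trans s0).
apply: nonincreasing_eleb_measurable => s t s0 st.
have t0 := lt_le_trans s0 st.
rewrite -[a]opprK !(powRN _ (- a)) lee_fin lef_pV2 ?posrE ?powR_gt0 //.
by rewrite ge0_ler_powR // ?nnegrE ?oppr_ge0 ltW.
Qed.

Lemma powR_comparable_le (a u l b : R) : (0 < a)%R -> (a <= u)%R -> (u <= l * a)%R ->
  (u `^ b <= l `^ `|b| * a `^ b)%R.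
Proof.
move=> a0 au ul; have u0 := lt_le_trans a0 au.
have l1 : (1 <= u / a)%R by rewrite ler_pdivlMr // mul1r.
have aV0 : (0 <= a^-1)%R by rewrite invr_ge0 ltW.
have l1' : (u / a <= l)%R by rewrite ler_pdivrMr.
rewrite -ler_pdivrMr ?powR_gt0 // -(powR_inv1 (powR_ge0 _ _)) powRAC.
rewrite (powR_inv1 (ltW a0)) -(powRM _ (ltW u0) aV0).
apply: (@le_trans _ _ ((u / a) `^ `|b|)%R).
  by apply: ler_powR => //; exact: ler_norm.
rewrite ge0_ler_powR ?nnegrE ?mulr_ge0 ?(ltW u0) //.
exact: le_trans (le_trans ler01 l1) l1'.
Qed.

Lemma powR_comparable_ge (a u l b : R) : (0 < a)%R -> (a <= u)%R -> (u <= l * a)%R ->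
  (a `^ b <= l `^ `|b| * u `^ b)%R.
Proof.
move=> a0 au ul; have u0 := lt_le_trans a0 au.
have := powR_comparable_le (- b) a0 au ul.
rewrite normrN !powRN ler_pdivlMr ?powR_gt0 // mulrC ler_pdivrMr ?powR_gt0 //.
Qed.

Lemma Lq_norm_cst q (a b : R) (c : \bar R) : 0 < q -> (a < b)%R -> 0 <= c ->
  Lq_norm q `[a, b[ (fun=> c) = c * ((b - a) `^ rinv q)%:E.
Proof.
move=> q0 ab c0; have mI := leb_measurable_itv `[a, b[.
have ba0 : (0 < b - a)%R by rewrite subr_gt0.
case: q q0 => [q|_|//].
  rewrite lte_fin => q0; rewrite -[LHS](@poweRVK _ _ q) ?Lq_norm_ge0 //.
  rewrite Lq_norm_fin_pow // integral_cst // gee0_abs //.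
  set m := (X in (_ * X) `^ _); have -> : m = (b - a)%:E.
    exact: leb_itv (ltW ab).
  rewrite poweRM ?poweR_ge0 ?lee_fin ?ltW //.
  by rewrite poweRVK // poweR_EFin /rinv /= inver gt_eqF.
rewrite /rinv /= powRr0 mule1 Lq_normE_oo; apply/eqP; rewrite eq_le; apply/andP; split.
  apply/ess_supP; apply: nearW => x /=; rewrite /patch; case: ifP => _.
    by rewrite gee0_abs.
  by rewrite abse0.
(* If [c] exceeded the essential supremum, the whole interval would lie in a null set. *)
have [cle|clt] := leP c (ess_sup leb (abse \o ((fun=> c) \_ `[a, b[))) => //.
have /ess_supP := lexx (ess_sup leb (abse \o ((fun=> c) \_ `[a, b[))).
move=> [N [mN N0 NI]].
have : leb `[a, b[ <= leb N.
  apply: le_measure; rewrite ?inE // => x Ix; apply: NI => /=.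
  apply/negP; rewrite -ltNge /patch ifT ?inE // gee0_abs //.
by rewrite N0 (leb_itv _ _ (ltW ab)) lee_fin leNgt ba0.
Qed.

(** The weight is constant up to a factor on a piece of ratio at most [l], and the length
    contributes [s^(1/q)]. Writing the exponent as [a - rinv q] leaves [s^a] for every q, including
    +oo. The value [y] is extended because it will be a value of f^* or of K. *)
Lemma Lq_norm_piece_le q (a l : R) : 0 < q -> (1 < l)%R ->
  exists2 C : R, (0 < C)%R & forall (s t : R) (y : \bar R) g,
    (0 < s)%R -> (t <= l * s)%R -> 0 <= y ->
    (forall u, (s <= u < t)%R -> 0 <= g u <= (u `^ (a - rinv q))%:E * y) ->
    Lq_norm q `[s, t[ g <= (C * s `^ a)%:E * y.
Proof.
move=> q0 l1; set b := (a - rinv q)%R.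
have l0 : (0 < l)%R by rewrite (lt_trans ltr01).
exists (l `^ `|b| * (l - 1) `^ rinv q)%R => [|s t y g s0 tl y0 gy].
  by rewrite mulr_gt0 // powR_gt0 // subr_gt0.
have sl : (s < l * s)%R by rewrite ltr_pMl.
apply: (@le_trans _ _ (Lq_norm q `[s, (l * s)%R[
    (fun=> (l `^ `|b| * s `^ b)%:E * y))).
  apply: Lq_norm_le => //.
  - by move=> u /=; rewrite !in_itv /= => /andP[-> /lt_le_trans]; apply.
  - move=> u /=; rewrite in_itv /= => /andP[su ut].
    have /andP[-> /=] : 0 <= g u <= (u `^ b)%:E * y by apply: gy; rewrite su.
    move=> /le_trans; apply; rewrite lee_wpmul2r // lee_fin.
    by apply: powR_comparable_le => //; rewrite ltW // (lt_le_trans ut).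
  - by move=> u _; rewrite mule_ge0 // lee_fin mulr_ge0 ?powR_ge0.
rewrite Lq_norm_cst //; last by rewrite mule_ge0 // lee_fin mulr_ge0 ?powR_ge0.
rewrite muleAC -EFinM lee_wpmul2r // lee_fin.
have -> : (l * s - s = (l - 1) * s)%R by rewrite mulrBl mul1r.
rewrite powRM ?subr_ge0 ?(ltW l1) ?(ltW s0) //.
have -> : (s `^ a = s `^ b * s `^ rinv q)%R.
  by rewrite -powRD ?subrK // (gt_eqF s0) implybT.
by rewrite le_eqVlt; apply/orP; left; apply/eqP; ring.
Qed.

(** Only the part [s, 2s) of the piece is kept, so no upper bound on [t] enters. *)
Lemma Lq_norm_piece_ge q (a : R) : 0 < q ->
  exists2 C : R, (0 < C)%R & forall (s t : R) (y : \bar R) g,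
    (0 < s)%R -> (2 * s <= t)%R -> 0 <= y ->
    (forall u, (s <= u < t)%R -> (u `^ (a - rinv q))%:E * y <= g u) ->
    (s `^ a)%:E * y <= C%:E * Lq_norm q `[s, t[ g.
Proof.
move=> q0; set b := (a - rinv q)%R.
exists (2 `^ `|b|)%R => [|s t y g s0 st y0 gy]; first by rewrite powR_gt0.
have s2 : (s < 2 * s)%R by rewrite ltr_pMl // ltr1n.
have b0 : (0 < 2 `^ `|b| :> R)%R by rewrite powR_gt0.
rewrite -lee_pdivrMl //.
apply: (@le_trans _ _ (Lq_norm q `[s, (2 * s)%R[ (fun=> ((2 `^ `|b|)^-1 * s `^ b)%:E * y))).
  rewrite Lq_norm_cst //; last by rewrite mule_ge0 // lee_fin mulr_ge0 ?powR_ge0 // invr_ge0 ltW.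
  have -> : (2 * s - s = s)%R by ring.
  rewrite muleAC muleA -!EFinM; apply: lee_wpmul2r => //; rewrite lee_fin -mulrA.
  by rewrite ler_wpM2l ?invr_ge0 ?powR_ge0 // -powRD ?subrK // (gt_eqF s0) implybT.
apply: Lq_norm_le => //.
- by move=> u /=; rewrite !in_itv /= => /andP[-> /lt_le_trans]; apply.
- move=> u /=; rewrite in_itv /= => /andP[su us]; apply/andP; split.
    by rewrite mule_ge0 // lee_fin mulr_ge0 ?powR_ge0 // invr_ge0 ltW.
  apply: le_trans (gy u _); last by rewrite su (lt_le_trans us).
  rewrite lee_wpmul2r // lee_fin ler_pdivrMl //.
  by apply: powR_comparable_ge => //; exact: ltW.
- move=> u /=; rewrite in_itv /= => us; apply: le_trans (gy u us).
  by rewrite mule_ge0 // lee_fin powR_ge0.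
Qed.

End pieces.

(** * Dyadic decomposition and power weights *)

Section powers.
Context {R : realType}.
Implicit Types (q : \bar R) (A B : set R) (g h : R -> \bar R).

Local Notation mR := (caratheodory_type (@wlength R idfun)^*%mu).
Local Notation leb := (@completed_lebesgue_measure R).

Section doubling_sequence.
Variable v : int -> R.
Hypothesis v0 : forall k, (0 < v k)%R.
Hypothesis v2 : forall k, (2 * v k <= v (k + 1))%R.

Lemma doubling_growth k n : (2 ^+ n * v k <= v (k + n%:Z))%R.
Proof.
elim: n => [|n IH]; first by rewrite expr0 mul1r addr0.
have -> : (k + n.+1%:Z = k + n%:Z + 1)%R by lia.
by apply: le_trans (v2 _); rewrite exprS -mulrA ler_pM2l.
Qed.

Lemma doubling_le j k : (j <= k)%R -> (v j <= v k)%R.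
Proof.
move=> jk; have -> : k = (j + `|(k - j)%R|%N%:Z)%R by lia.
apply: le_trans (doubling_growth _ _).
by rewrite ler_peMl ?(ltW (v0 _)) // exprn_ege1 // ler1n.
Qed.

Lemma doubling_unbounded (x : R) k : (0 < x)%R -> exists n : nat, (x < 2 ^+ n * v k)%R.
Proof.
move=> x0; exists (Num.Def.archi_bound (x / v k)).
rewrite -ltr_pdivrMr //; apply: lt_le_trans (archi_boundP _) _.
  by rewrite divr_ge0 // ltW.
by rewrite -natrX ler_nat ltnW // ltn_expl.
Qed.

Lemma doubling_trivIset : trivIset setT (fun k => `[v k, v (k + 1)%R[%classic).
Proof.
move=> i j _ _ [x [/=]]; rewrite !in_itv /= => /andP[ix xi] /andP[jx xj].
have [ij|ji|//] := ltgtP i j.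
  have /doubling_le : (i + 1 <= j)%R by lia.
  by move=> /(lt_le_trans xi); rewrite ltNge jx.
have /doubling_le : (j + 1 <= i)%R by lia.
by move=> /(lt_le_trans xj); rewrite ltNge ix.
Qed.

Lemma doubling_cover : \bigcup_k `[v k, v (k + 1)%R[%classic = `]0%R, +oo[%classic.
Proof.
apply/seteqP; split => x /=.
  by move=> [k _ /=]; rewrite !in_itv /= andbT => /andP[/(lt_le_trans (v0 k))].
rewrite in_itv /= andbT => x0.
have [n nx] : exists n : nat, (v (- n%:Z) <= x)%R.
  have [n] := doubling_unbounded 0 (divr_gt0 (v0 0) (divr_gt0 x0 (v0 0))).
  rewrite invf_div mulrA => Hn; exists n.
  have := doubling_growth (- n%:Z) n; rewrite addNr.
  have : (v 0 < 2 ^+ n * x)%R.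
    by move: Hn; rewrite ltr_pdivrMr // mulrAC ltr_pM2r.
  move=> /[swap] /le_lt_trans /[apply]; rewrite ltr_pM2l ?exprn_gt0 //.
  exact: ltW.
have ex : exists m : nat, (x < v (- n%:Z + m%:Z))%R.
  have [m mx] := doubling_unbounded (- n%:Z) x0.
  by exists m; apply: lt_le_trans mx (doubling_growth _ _).
(* The least [m] is positive because [v (- n) <= x]; its predecessor indexes the piece that contains
   [x]. *)
case: (ex_minnP ex) => m xm mmin.
have m0 : (0 < m)%N.
  by case: m xm mmin => // + _; rewrite addr0 ltNge nx.
exists (- n%:Z + m.-1%:Z)%R => //=; rewrite in_itv /=; apply/andP; split.
  rewrite leNgt; apply/negP => /mmin; lia.
by rewrite -addrA -PoszD addn1 prednK.
Qed.

(** The points need not be powers of a number: besides the geometric scale, this is applied to the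
    values of [balance] along it, in place of a change of variable. *)
Lemma Lq_norm_doubling q g : 0 < q -> eleb_measurable `]0%R, +oo[ g ->
  Lq_norm q `]0%R, +oo[ g = ell q (fun k => Lq_norm q `[v k, v (k + 1)%R[ g).
Proof.
move=> q0 mg; rewrite -doubling_cover Lq_norm_bigcup ?doubling_cover //.
- by move=> k; exact: leb_measurable_itv.
- exact: doubling_trivIset.
Qed.

End doubling_sequence.

Lemma ell_single q (c : \bar R) : 0 < q -> 0 <= c ->
  ell q (fun j : int => if j == 0%R then c else 0) = c.
Proof.
move=> q0 c0; case: q q0 => [q|_|//] /=.
  rewrite lte_fin => q0; rewrite -[RHS](poweRVK q0) //; congr (_ `^ _).
  rewrite (_ : [set: int] = [set 0%R] `|` ~` [set 0%R]); last by rewrite setUv.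
  rewrite (esumID [set 0%R]); last by move=> *; exact: poweR_ge0.
  rewrite [X in _ + X]esum1 ?adde0; last first.
    by move=> i /= [_ /eqP /negbTE ->]; rewrite poweR0r // gt_eqF.
  rewrite setUv setTI esum_set1 ?eqxx // poweR_ge0 //.
apply/eqP; rewrite eq_le; apply/andP; split.
  by apply: ge_ereal_sup => _ [k _ <-]; case: ifP.
by apply: ereal_sup_ubound; exists 0%R => //; rewrite eqxx.
Qed.

Lemma eleb_measurable_powRZ (a k : R) A : leb_measurable A -> A `<=` `]0%R, +oo[ ->
  eleb_measurable A (fun u => (k * u `^ a)%:E).
Proof.
move=> mA A0; under eq_fun do rewrite EFinM.
apply: emeasurable_funM; first exact: measurable_cst.
apply: (@measurable_funS _ _ mR (\bar R) `]0%R, +oo[) => //.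
  exact: leb_measurable_itv.
exact: powR_eleb_measurable.
Qed.

Lemma ler0_absz (k : int) : (k <= 0)%R -> (k%:~R = - `|k|%N%:R :> R)%R.
Proof. by case: k => [[|n]|n] // _; rewrite ?oppr0. Qed.

Lemma ger0_absz (k : int) : (0 <= k)%R -> (k%:~R = `|k|%N%:R :> R)%R.
Proof. by case: k. Qed.

(* Each dyadic piece is bounded separately, and [ell_geom] applied to a sequence
   supported at one index sums the resulting geometric decay. *)
Lemma Lq_norm_hump q (a b : R) : 0 < q -> (0 < a)%R -> (0 < b)%R ->
  exists2 C : R, (0 < C)%R & forall (c t : R) g,
    (0 <= c)%R -> (0 < t)%R ->
    (forall u, (0 < u < t)%R -> 0 <= g u <= (c * t `^ (- a) * u `^ (a - rinv q))%:E) ->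
    (forall u, (t <= u)%R -> 0 <= g u <= (c * t `^ b * u `^ (- b - rinv q))%:E) ->
    Lq_norm q `]0%R, +oo[ g <= (C * c)%:E.
Proof.
move=> q0 a0 b0; pose m := Num.min a b.
have m0 : (0 < m)%R by rewrite lt_min a0.
have l2 : (1 < 2 :> R)%R by rewrite ltr1n.
have [C1 C10 H1] := Lq_norm_piece_le a q0 l2.
have [C2 C20 H2] := Lq_norm_piece_le (- b) q0 l2.
pose w : R := (2 `^ m)%R.
have w1 : (1 < w)%R.
  have := @gt0_ltr_powR _ m m0 1%R 2%R; rewrite powR1; apply=> //; rewrite nnegrE; lra.
have C0 : (0 <= C1 + C2)%R by rewrite addr_ge0 // ltW.
have [C C'0 HC] := ell_geom q0 w1 C0.
exists C => // c t g c0 t0 gl gr.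
(* [g] is not assumed measurable; the decomposition into pieces is applied to this explicit
   majorant. *)
pose h u : \bar R := if (u < t)%R then (c * t `^ (- a) * u `^ (a - rinv q))%:E
  else (c * t `^ b * u `^ (- b - rinv q))%:E.
have h0 u : 0 <= h u.
  by rewrite /h; case: ifP => _; rewrite lee_fin !mulr_ge0 // powR_ge0.
have gh u : (0 < u)%R -> 0 <= g u <= h u.
  by move=> u0; rewrite /h; case: ltP => ut; [apply: gl; rewrite u0|exact: gr].
have mh : eleb_measurable `]0%R, +oo[ h.
  have -> : `]0%R, +oo[%classic = `]0%R, t[%classic `|` `[t, +oo[%classic.
    apply/seteqP; split => x /=; rewrite !in_itv /= !andbT.
      by move=> x0; case: (ltP x t) => xt; [left|right]; rewrite ?x0.
    by move=> [/andP[]//|]; exact: lt_le_trans.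
  apply/measurable_funU; [exact: leb_measurable_itv|exact: leb_measurable_itv|split].
    apply: (@eq_measurable_fun _ _ mR (\bar R) _ (fun u : R => (c * t `^ (- a) * u `^ (a - rinv q))%:E)).
      by move=> u; rewrite inE /= in_itv /= /h => /andP[_ ->].
    apply: eleb_measurable_powRZ; first exact: leb_measurable_itv.
    by move=> u /=; rewrite !in_itv /= => /andP[->].
  apply: (@eq_measurable_fun _ _ mR (\bar R) _ (fun u : R => (c * t `^ b * u `^ (- b - rinv q))%:E)).
    by move=> u; rewrite inE /= in_itv /= andbT /h ltNge => ->.
  apply: eleb_measurable_powRZ; first exact: leb_measurable_itv.
  by move=> u /=; rewrite !in_itv /= !andbT; exact: lt_le_trans.
(* Starting the scale at [t] puts the peak at index 0, so the distance to it is |k|. *)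
pose v (k : int) : R := (t * 2 `^ k%:~R)%R.
have v0 k : (0 < v k)%R by rewrite mulr_gt0 // powR_gt0.
have vS k : (v (k + 1) = 2 * v k)%R.
  rewrite /v intrD powRD ?powRr1 //; first by rewrite mulrA mulrC.
  by rewrite pnatr_eq0 implybT.
apply: (@le_trans _ _ (Lq_norm q `]0%R, +oo[ h)).
  by apply: Lq_norm_le => // u /=; rewrite in_itv /= andbT; exact: gh.
rewrite (@Lq_norm_doubling v) //; last by move=> k; rewrite vS.
pose z (j : int) : \bar R := if j == 0%R then c%:E else 0.
rewrite EFinM; have <- : ell q z = c%:E by rewrite /z ell_single.
apply: HC.
- by move=> k; exact: Lq_norm_ge0.
- by move=> k; rewrite /z; case: ifP; rewrite lee_fin.
move=> k B B0 zB.
have := zB 0%R; rewrite /z eqxx sub0r abszN lee_fin => cB.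
have w0 : (0 < w)%R by rewrite powR_gt0.
have [k0|k0] := ltP k 0%R.
  apply: (@le_trans _ _ ((C1 * v k `^ a)%:E * (c * t `^ (- a))%:E)).
    apply: H1 => //; first by rewrite vS.
      by rewrite lee_fin mulr_ge0 // powR_ge0.
    move=> u /andP[ku uk]; rewrite h0 /= /h ifT.
      by rewrite -EFinM lee_fin mulrC.
    apply: lt_le_trans uk _.
    rewrite /v -[leRHS]mulr1 ler_pM2l // -[leRHS](powRr0 2); apply: ler_powR; rewrite ?ler1n //.
    by rewrite lerz0 lezD1.
  rewrite -EFinM lee_fin.
  rewrite {1}/v powRM ?(ltW t0) ?powR_ge0 //.
  have -> : (C1 * (t `^ a * (2 `^ k%:~R) `^ a) * (c * t `^ (- a)) =
     C1 * ((t `^ a * t `^ (- a)) * ((2 `^ k%:~R) `^ a * c)))%R by ring.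
  rewrite powRN mulfV ?gt_eqF ?powR_gt0 // mul1r.
  have kE := ler0_absz (ltW k0).
  apply: (@le_trans _ _ (C1 * B)%R); last first.
    by rewrite ler_wpM2r // lerDl ltW.
  rewrite ler_pM2l // -powRrM kE mulNr powRN ler_pdivrMl ?powR_gt0 //.
  apply: le_trans cB _; rewrite ler_wpM2r //.
  rewrite /w -powR_mulrn ?powR_ge0 // -powRrM mulrC; apply: ler_powR; rewrite ?ler1n //.
  by rewrite ler_wpM2l // ge_min lexx.
apply: (@le_trans _ _ ((C2 * v k `^ (- b))%:E * (c * t `^ b)%:E)).
  apply: H2 => //; first by rewrite vS.
    by rewrite lee_fin mulr_ge0 // powR_ge0.
  move=> u /andP[ku uk]; rewrite h0 /= /h ifF.
    by rewrite -EFinM lee_fin mulrC.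
  apply/negbTE; rewrite -leNgt; apply: le_trans ku.
  rewrite /v -[leLHS]mulr1 ler_pM2l // -[leLHS](powRr0 2); apply: ler_powR; rewrite ?ler1n //.
  by rewrite ler0z.
rewrite -EFinM lee_fin.
rewrite {1}/v powRM ?(ltW t0) ?powR_ge0 //.
have -> : (C2 * (t `^ (- b) * (2 `^ k%:~R) `^ (- b)) * (c * t `^ b) =
   C2 * ((t `^ b * t `^ (- b)) * ((2 `^ k%:~R) `^ (- b) * c)))%R by ring.
rewrite (powRN t) mulfV ?gt_eqF ?powR_gt0 // mul1r.
have kE := ger0_absz k0.
apply: (@le_trans _ _ (C2 * B)%R); last first.
  by rewrite ler_wpM2r // lerDr ltW.
rewrite ler_pM2l // -powRrM kE mulrN powRN ler_pdivrMl ?powR_gt0 //.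
apply: le_trans cB _; rewrite ler_wpM2r //.
rewrite /w -powR_mulrn ?powR_ge0 // -powRrM mulrC; apply: ler_powR; rewrite ?ler1n //.
by rewrite ler_wpM2l // ge_min lexx orbT.
Qed.

End powers.

(** * Half-lines, scaling and unions *)

Section consequences.
Context {R : realType}.
Implicit Types (q : \bar R) (A B : set R) (g h : R -> \bar R).

Local Notation mR := (caratheodory_type (@wlength R idfun)^*%mu).
Local Notation leb := (@completed_lebesgue_measure R).

Lemma Lq_norm_restrict q A B g : A `<=` B ->
  Lq_norm q A g = Lq_norm q B (g \_ A).
Proof.
move=> AB; rewrite /Lq_norm; congr Lnorm; apply/funext => x.
rewrite /patch; case: ifPn => [Ax|]; last by case: ifP.
by rewrite ifT // inE; apply: AB; rewrite inE in Ax.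
Qed.

(** One slope of the hump: extended by zero beyond [t], the function satisfies the other bound with
    any exponent, here 1. *)
Lemma Lq_norm_near0 q (a : R) : 0 < q -> (0 < a)%R ->
  exists2 C : R, (0 < C)%R & forall (c t : R) g, (0 <= c)%R -> (0 < t)%R ->
    (forall u, (0 < u < t)%R -> 0 <= g u <= (c * u `^ (a - rinv q))%:E) ->
    Lq_norm q `]0%R, t[ g <= (C * (c * t `^ a))%:E.
Proof.
move=> q0 a0; have [C C0 H] := Lq_norm_hump q0 a0 ltr01.
exists C => // c t g c0 t0 gle.
rewrite (@Lq_norm_restrict _ _ `]0%R, +oo[); last first.
  by move=> u /=; rewrite !in_itv /= => /andP[->].
apply: (H _ t) => //; first by rewrite mulr_ge0 // powR_ge0.
  move=> u ut; rewrite /patch ifT ?inE //= ?in_itv //.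
  by rewrite -(mulrA c) powRN mulfV ?mulr1 ?gt_eqF ?powR_gt0 //; exact: gle.
move=> u tu; rewrite /patch; case: ifPn => [|_].
  by rewrite inE /= in_itv /= (ltNge u) tu andbF.
by rewrite lexx /= lee_fin !mulr_ge0 ?powR_ge0.
Qed.

Lemma Lq_norm_atoo q (b : R) : 0 < q -> (0 < b)%R ->
  exists2 C : R, (0 < C)%R & forall (c t : R) g, (0 <= c)%R -> (0 < t)%R ->
    (forall u, (t < u)%R -> 0 <= g u <= (c * u `^ (- b - rinv q))%:E) ->
    Lq_norm q `]t, +oo[ g <= (C * (c * t `^ (- b)))%:E.
Proof.
move=> q0 b0; have [C C0 H] := Lq_norm_hump q0 ltr01 b0.
exists C => // c t g c0 t0 gle.
rewrite (@Lq_norm_restrict _ _ `]0%R, +oo[); last first.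
  by move=> u /=; rewrite !in_itv /= !andbT; exact: lt_trans.
apply: (H _ t) => //; first by rewrite mulr_ge0 // powR_ge0.
  move=> u /andP[u0 ut]; rewrite /patch; case: ifPn => [|_].
    by rewrite inE /= in_itv /= ltNge ltW.
  by rewrite lexx /= lee_fin !mulr_ge0 ?powR_ge0.
move=> u tu; rewrite /patch; case: ifPn => [|_].
  rewrite inE /= in_itv /= andbT => tu'.
  by rewrite -(mulrA c) powRN mulVf ?mulr1 ?gt_eqF ?powR_gt0 //; exact: gle.
by rewrite lexx /= lee_fin !mulr_ge0 ?powR_ge0.
Qed.

Lemma Lq_norm_Zle q A (c : R) g : 0 < q -> (0 < c)%R -> leb_measurable A ->
  eleb_measurable A g ->
  Lq_norm q A (fun u => c%:E * g u) <= c%:E * Lq_norm q A g.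
Proof.
move=> q0 c0 mA mg; case: q q0 => [q|_|//]; last first.
  rewrite !Lq_normE_oo; apply/ess_supP.
  have /ess_supP := lexx (ess_sup leb (abse \o (g \_ A))).
  apply: (@filterS _ _ (ae_filter_ringOfSetsType leb)) => x /=.
  rewrite /patch; case: ifP => _ gx; last first.
    by move: gx; rewrite abse0 => gx; rewrite mule_ge0 // lee_fin ltW.
  by rewrite abseM (gee0_abs (_ : 0 <= c%:E)) ?lee_fin ?(ltW c0) // lee_wpmul2l // lee_fin ltW.
rewrite lte_fin => q0; have cE0 : 0 <= c%:E by rewrite lee_fin ltW.
rewrite -[leLHS](@poweRVK _ _ q) ?Lq_norm_ge0 //.
rewrite -[Lq_norm _ _ g](@poweRVK _ _ q) ?Lq_norm_ge0 //.
rewrite -[c%:E in leRHS](@poweRVK _ _ q) // -poweRM ?poweR_ge0 //.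
rewrite !(Lq_norm_fin_pow _ q0 mA) poweR_EFin.
have mgq := @measurable_fun_abse_poweR _ q _ _ mA mg.
rewrite -(@ge0_integralZl_EFin _ _ _ leb _ mA _ _ mgq) ?powR_ge0 //; last first.
  by move=> x _; exact: poweR_ge0.
rewrite le_eqVlt; apply/orP; left; apply/eqP; congr (_ `^ _).
apply: eq_integral => x _.
by rewrite abseM poweRM ?abse_ge0 // gee0_abs // poweR_EFin.
Qed.

(** The q-th powers add over a disjoint union and [a^q + b^q <= 2 (a + b)^q] for every q > 0, which
    gives the constant [2^(1/q)]. *)
Lemma Lq_norm_setU q : 0 < q -> exists2 C : R, (0 < C)%R & forall A B g,
  leb_measurable A -> leb_measurable B -> eleb_measurable (A `|` B) g ->
  Lq_norm q (A `|` B) g <= C%:E * (Lq_norm q A g + Lq_norm q B g).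
Proof.
case: q => [q|_|//]; last first.
  exists 1%R => // A B g mA mB mg; rewrite mul1e !Lq_normE_oo; apply/ess_supP.
  have /ess_supP := lexx (ess_sup leb (abse \o (g \_ A))).
  have /ess_supP := lexx (ess_sup leb (abse \o (g \_ B))).
  apply: (@filterS2 _ _ (ae_filter_ringOfSetsType leb)) => x /= gB gA.
  have a0 : 0 <= ess_sup leb (abse \o (g \_ A)) by apply: le_trans gA; exact: abse_ge0.
  have b0 : 0 <= ess_sup leb (abse \o (g \_ B)) by apply: le_trans gB; exact: abse_ge0.
  rewrite [in leLHS]/patch; case: ifPn; last by rewrite abse0 adde_ge0.
  rewrite inE => -[Ax|Bx].
    by move: gA; rewrite {1}/patch ifT ?inE // => /le_trans; apply; rewrite leeDl.
  by move: gB; rewrite {1}/patch ifT ?inE // => /le_trans; apply; rewrite leeDr.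
rewrite lte_fin => q0; exists (2 `^ q^-1)%R => [|A B g mA mB mg].
  by rewrite powR_gt0.
have qE : 0 < q%:E by rewrite lte_fin.
set a := Lq_norm _ A g; set b := Lq_norm _ B g.
have a0 : 0 <= a by exact: Lq_norm_ge0.
have b0 : 0 <= b by exact: Lq_norm_ge0.
have mAB : leb_measurable (A `|` B) by apply: measurableU.
rewrite -[leLHS](@poweRVK _ _ q) ?Lq_norm_ge0 //.
rewrite -[_ + _](@poweRVK _ _ q) ?adde_ge0 // -poweR_EFin -poweRM ?lee_fin ?poweR_ge0 //.
apply: le_poweR; [by rewrite invr_ge0 ltW|exact: poweR_ge0|].
have AE : A `|` ((A `|` B) `\` A) = A `|` B by rewrite setDUK //; exact: subsetUl.
rewrite Lq_norm_fin_pow // -AE.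
have mBA : leb_measurable ((A `|` B) `\` A) by apply: measurableD.
have mgq := @measurable_fun_abse_poweR _ q _ _ mAB mg.
have gq0 x : 0 <= `|g x| `^ q by exact: poweR_ge0.
rewrite (@ge0_integral_setU _ _ _ leb _ _ mA mBA); last 3 first.
- by rewrite AE.
- by move=> x _; exact: gq0.
- by apply/disj_setPS => x [? []].
have -> : \int[leb]_(x in A) `|g x| `^ q = a `^ q by rewrite Lq_norm_fin_pow.
apply: (@le_trans _ _ (a `^ q + b `^ q)).
  rewrite leeD2l // Lq_norm_fin_pow //.
  apply: (@ge0_subset_integral _ _ _ leb _ _ mBA mB).
  - apply: measurable_fun_abse_poweR => //.
    by apply: measurable_funS mg => //; exact: subsetUr.
  - by move=> *; exact: poweR_ge0.
  - by move=> x [[|] //].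
have abq x : 0 <= x -> x <= a + b -> x `^ q <= (a + b) `^ q.
  by move=> x0 xab; apply: le_poweR => //; exact: ltW.
rewrite mule_natl mule2n.
by apply: leeD; apply: abq => //; [rewrite leeDl|rewrite leeDr].
Qed.

End consequences.

(** * Slowly varying weights and their tails *)

Section slowly_varying.
Context {R : realType}.
Variable b : R -> R.
Hypothesis SVb : SV b.

Lemma SV_increasing (e : R) : (0 < e)%R -> exists2 C : R, (0 < C)%R &
  forall s t, (0 < s)%R -> (s <= t)%R -> (s `^ e * b s <= C * (t `^ e * b t))%R.
Proof.
case: SVb => _ _ /(_ e) H /H[[g [g0 gm [C C0 HC]]] _].
exists (C * C)%R => [|s t s0 st]; first by rewrite mulr_gt0.
have [sg _] := HC s s0; have [_ gt] := HC t (lt_le_trans s0 st).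
rewrite (le_trans sg) // -mulrA ler_pM2l // (le_trans _ gt) //.
exact: gm.
Qed.

Variable r : \bar R.
Hypothesis r0 : 0 < r.
Hypothesis tail1 : tail_norm r b 1 < +oo.

Let g (s : R) := (s `^ (- rinv r) * b s)%:E.

Let b0 t : (0 < t)%R -> (0 < b t)%R.
Proof. by case: SVb => _ + _; apply. Qed.

Let g0 t : (0 < t)%R -> 0 <= g t.
Proof. by move=> t0; rewrite lee_fin mulr_ge0 ?powR_ge0 // ltW // b0. Qed.

Lemma SV_weight_measurable :
  eleb_measurable `]0%R, +oo[ (fun s => (s `^ (- rinv r) * b s)%:E).
Proof.
have -> : (fun s : R => (s `^ (- rinv r) * b s)%:E) =
    (fun s : R => (s `^ (- rinv r))%:E * (b s)%:E).
  by apply/funext => s; rewrite EFinM.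
apply: emeasurable_funM; first exact: powR_eleb_measurable.
by apply/measurable_EFinP; case: SVb.
Qed.


Lemma tail_norm_split : exists2 C : R, (0 < C)%R & forall s t : R,
  (0 < s)%R -> (s <= t)%R ->
  tail_norm r b s <= C%:E * (Lq_norm r `]s, t] g + tail_norm r b t).
Proof.
have [C C0 H] := Lq_norm_setU r0; exists C => // s t s0 st.
have E : `]s, +oo[%classic = `]s, t]%classic `|` `]t, +oo[%classic.
  apply/seteqP; split => x /=; rewrite !in_itv /= !andbT.
    by move=> x0; case: (leP x t) => xt; [left|right]; rewrite ?x0.
  by move=> [/andP[]//|]; exact: le_lt_trans.
rewrite {1}/tail_norm E; apply: H; [exact: leb_measurable_itv|exact: leb_measurable_itv|].
rewrite -E; apply: measurable_funS SV_weight_measurable; first exact: leb_measurable_itv.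
by move=> x /=; rewrite !in_itv /= !andbT; exact: lt_trans.
Qed.

(** For u in (s, t] slow variation gives [b(u) <= C (t/u)^e b(t)]; the norm of the remaining power
    [u^(-e-1/r)] may then be taken up to infinity. *)
Lemma SV_piece_le (e : R) : (0 < e)%R -> exists2 C : R, (0 < C)%R & forall s t : R,
  (0 < s)%R -> (s <= t)%R ->
  Lq_norm r `]s, t] g <= (C * ((t / s) `^ e * b t))%:E.
Proof.
move=> e0; have [C C0 H] := SV_increasing e0.
have [D D0 HD] := Lq_norm_atoo r0 e0.
exists (D * C)%R => [|s t s0 st]; first by rewrite mulr_gt0.
have t0 := lt_le_trans s0 st; have bt := ltW (b0 t0).
rewrite (@Lq_norm_restrict _ _ _ `]s, +oo[); last first.
  by move=> u /=; rewrite !in_itv /= => /andP[->].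
apply: le_trans (HD (C * (t `^ e * b t))%R s _ _ s0 _) _.
- by rewrite !mulr_ge0 ?powR_ge0 // ltW.
- move=> u su; have u0 := lt_trans s0 su.
  rewrite /patch; case: ifPn => [|_]; last first.
    by rewrite lexx /= lee_fin !mulr_ge0 ?powR_ge0 // ltW.
  rewrite inE /= in_itv /= => /andP[_ ut]; rewrite g0 //= lee_fin.
  rewrite (powRD (r := - e)) ?(gt_eqF u0) ?implybT // mulrA mulrC.
  rewrite ler_wpM2r ?powR_ge0 // powRN ler_pdivlMr ?powR_gt0 // mulrC.
  exact: H.
have -> : ((t / s) `^ e = t `^ e * s `^ (- e))%R.
  rewrite powRM ?invr_ge0 ?(ltW t0) ?(ltW s0) //.
  by rewrite -(powR_inv1 (ltW s0)) -powRrM mulN1r.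
by rewrite le_eqVlt; apply/orP; left; apply/eqP; congr EFin; ring.
Qed.

(** Finiteness at 1 passes to smaller t because the norm over (t, 1] is finite. *)
Lemma tail_norm_lty t : (0 < t)%R -> tail_norm r b t < +oo.
Proof.
move=> t0; have [C C0 H] := tail_norm_split.
have [D D0 HD] := SV_piece_le ltr01.
have [t1|t1] := leP t 1%R; last first.
  apply: le_lt_trans tail1; apply: Lq_norm_le => //.
  - by move=> u /=; rewrite !in_itv /= !andbT; exact: lt_trans.
  - move=> u /=; rewrite in_itv /= andbT => tu; rewrite lexx andbT.
    exact/g0/(lt_trans t0).
  - by move=> u /=; rewrite in_itv /= andbT => tu; apply/g0/(lt_trans ltr01).
apply: le_lt_trans (H t 1%R t0 t1) _.
rewrite lte_mul_pinfty ?lee_fin ?(ltW C0) //.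
by rewrite lte_add_pinfty // (le_lt_trans (HD _ _ t0 t1)) // ltry.
Qed.

Lemma tail_norm_ge0 t : 0 <= tail_norm r b t.
Proof. exact: Lq_norm_ge0. Qed.

Lemma tail_normE t : (0 < t)%R -> (fine (tail_norm r b t))%:E = tail_norm r b t.
Proof. by move=> t0; rewrite fineK // ge0_fin_numE ?tail_norm_ge0 // tail_norm_lty. Qed.

Lemma tail_norm_nonincreasing s t : (0 < s)%R -> (s <= t)%R ->
  (fine (tail_norm r b t) <= fine (tail_norm r b s))%R.
Proof.
move=> s0 st; have t0 := lt_le_trans s0 st; rewrite -lee_fin !tail_normE //.
apply: Lq_norm_le => //.
- by move=> u /=; rewrite !in_itv /= !andbT; exact: le_lt_trans.
- move=> u /=; rewrite in_itv /= andbT => tu; rewrite lexx andbT.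
  exact/g0/(lt_trans t0).
- by move=> u /=; rewrite in_itv /= andbT => tu; apply/g0/(lt_trans s0).
Qed.

(** The piece [2t, 4t) of the tail suffices: there [t b(t) <= C u b(u) <= 4 C t b(u)]. It starts at
    2t because the tail interval is open at t. *)
Lemma SV_le_tail_norm : exists2 C : R, (0 < C)%R & forall t, (0 < t)%R ->
  (b t <= C * fine (tail_norm r b t))%R.
Proof.
have [C C0 H] := SV_increasing ltr01.
have [D D0 HD] := @Lq_norm_piece_ge R r 0 r0.
exists (4 * C * D)%R => [|t t0]; first by rewrite !mulr_gt0.
have K0 : (0 < (4 * C)^-1)%R by rewrite invr_gt0 mulr_gt0.
rewrite -mulrA -ler_pdivrMl ?mulr_gt0 // -lee_fin [leRHS]EFinM tail_normE //.
apply: (@le_trans _ _ (D%:E * Lq_norm r `[(2 * t)%R, (4 * t)%R[ g)).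
  have := HD (2 * t)%R (4 * t)%R ((4 * C)^-1 * b t)%:E g.
  rewrite powRr0 mul1e; apply.
  - by rewrite mulr_gt0.
  - by rewrite mulrA ler_pM2r // -natrM.
  - by rewrite lee_fin mulr_ge0 // ltW // b0.
  - move=> u /andP[tu ut]; have tu' : (t <= u)%R by lra.
    have u0 := lt_le_trans t0 tu'.
    rewrite sub0r -EFinM lee_fin ler_wpM2l ?powR_ge0 //.
    rewrite ler_pdivrMl ?mulr_gt0 //.
    have := H _ _ t0 tu'; rewrite !powRr1 ?(ltW t0) ?(ltW u0) // => Htu.
    rewrite -(ler_pM2l t0); apply: le_trans Htu _.
    have bu := b0 u0.
    have -> : (t * (4 * C * b u) = C * ((4 * t) * b u))%R by ring.
    by rewrite ler_pM2l // ler_pM2r // ltW.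
rewrite lee_pmul2l //; apply: Lq_norm_le => //.
- by move=> u /=; rewrite !in_itv /= andbT => /andP[tu _]; lra.
- move=> u /=; rewrite in_itv /= => /andP[tu _]; rewrite lexx andbT.
  by apply: g0; lra.
- by move=> u /=; rewrite in_itv /= andbT => tu; apply/g0/(lt_trans t0).
Qed.

Lemma tail_norm_gt0 t : (0 < t)%R -> (0 < fine (tail_norm r b t))%R.
Proof.
move=> t0; have [C C0 H] := SV_le_tail_norm.
by rewrite -(pmulr_rgt0 _ C0) (lt_le_trans (b0 t0)) // H.
Qed.

(** Slow variation of the tail itself: the part over (s, t] costs [(t/s)^e b(t)], and [b(t)] is at
    most a multiple of the tail at t. *)
Lemma tail_norm_decay (e : R) : (0 < e)%R -> exists2 C : R, (0 < C)%R & forall s t : R,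
  (0 < s)%R -> (s <= t)%R ->
  (fine (tail_norm r b s) <= C * (t / s) `^ e * fine (tail_norm r b t))%R.
Proof.
move=> e0; have [C C0 HC] := tail_norm_split.
have [D D0 HD] := SV_piece_le e0.
have [K K0 HK] := SV_le_tail_norm.
exists (C * (D * K + 1))%R => [|s t s0 st].
  by rewrite mulr_gt0 // ltr_wpDl // mulr_ge0 // ltW.
have t0 := lt_le_trans s0 st.
have ts1 : (1 <= (t / s) `^ e)%R.
  rewrite -(powRr0 (t / s)); apply: ler_powR; last exact: ltW.
  by rewrite ler_pdivlMr // mul1r.
rewrite -lee_fin tail_normE //; apply: le_trans (HC _ _ s0 st) _.
rewrite -mulrA -mulrA EFinM lee_pmul2l // -(tail_normE t0).
apply: (@le_trans _ _ ((D * ((t / s) `^ e * b t))%:E + (fine (tail_norm r b t))%:E)).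
  by rewrite leeD2r // HD.
rewrite -EFinD lee_fin mulrDl mul1r; apply: lerD.
  rewrite -mulrA ler_pM2l // [leRHS]mulrCA ler_pM2l ?HK //.
  by rewrite (lt_le_trans ltr01).
by rewrite ler_peMl // ltW // tail_norm_gt0.
Qed.

End slowly_varying.

(** * Rearrangements *)

Section rearrangement.
Context {d : measure_display} {T : measurableType d} {R : realType}.
Variable mu : {measure set T -> \bar R}.
Implicit Types (f g : T -> R).

Lemma rearr_ge0 f t : 0 <= rearr mu f t.
Proof. by apply: le_ereal_inf_tmp => _ [l [l0 _] <-]; rewrite lee_fin. Qed.

Lemma rearr_nonincreasing f s t : (s <= t)%R -> rearr mu f t <= rearr mu f s.
Proof.
move=> st; apply: ereal_inf_le_tmp => _ [l [l0 lf] <-]; exists l => //; split=> //.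
by rewrite (le_trans lf) // lee_fin.
Qed.

Lemma measurable_level f (l : R) : measurable_fun setT f ->
  measurable [set x | (l < `|f x|)%R].
Proof.
move=> mf; rewrite (_ : [set x | _] = setT `&` (fun x => `|f x|%R) @^-1` `]l, +oo[%classic).
  by apply: (measurableT_comp (@normr_measurable R setT) mf) => //; exact: measurable_itv.
by apply/seteqP; split=> x /=; rewrite in_itv /= andbT => // -[].
Qed.

Lemma rearr_le f g t : measurable_fun setT f -> measurable_fun setT g ->
  (forall x, (`|f x| <= `|g x|)%R) -> rearr mu f t <= rearr mu g t.
Proof.
move=> mf mg fg; apply: ereal_inf_le_tmp => _ [l [l0 lg] <-]; exists l => //; split=> //.
apply: le_trans lg; apply: le_measure; rewrite ?inE; try exact: measurable_level.
by move=> x /= /lt_le_trans; apply.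
Qed.

Lemma rearr_le_cst f (M t : R) : (0 <= M)%R -> (0 <= t)%R ->
  (forall x, (`|f x| <= M)%R) -> rearr mu f t <= M%:E.
Proof.
move=> M0 t0 fM; apply: ereal_inf_lbound; exists M => //; split=> //.
rewrite (_ : [set x | _] = set0) ?measure0 ?lee_fin //.
by apply/seteqP; split=> x //=; rewrite ltNge fM.
Qed.

Lemma rearr_eq0 f t : mu [set x | (0 < `|f x|)%R] <= t%:E -> rearr mu f t = 0.
Proof.
move=> ft; apply/eqP; rewrite eq_le rearr_ge0 andbT.
by apply: ereal_inf_lbound; exists 0%R.
Qed.

(* By continuity from below of mu at the level tau. *)
Lemma rearr_attained f (t tau : R) : measurable_fun setT f ->
  rearr mu f t = tau%:E -> mu [set x | (tau < `|f x|)%R] <= t%:E.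
Proof.
move=> mf Etau.
pose F (n : nat) := [set x | (tau + n.+1%:R^-1 < `|f x|)%R].
have mF n : measurable (F n) by exact: measurable_level.
have FE : [set x | (tau < `|f x|)%R] = \bigcup_n F n.
  apply/seteqP; split=> x /=; last first.
    by move=> [n _] /=; apply: lt_trans; rewrite ltrDl invr_gt0.
  move=> taux; have d0 : (0 < `|f x| - tau)%R by rewrite subr_gt0.
  have := near_infty_natSinv_lt (PosNum d0) => -[N _ /(_ N (leqnn N))] /= HN.
  by exists N => //; rewrite /F /= -ltrBrDl.
have Fnd : nondecreasing_seq F.
  move=> m n mn; apply/subsetPset => x /=; apply: le_lt_trans.
  by rewrite lerD2l lef_pV2 ?posrE // ler_nat.
rewrite FE; have := @nondecreasing_cvg_mu _ _ _ mu _ mF (bigcupT_measurable _ mF) Fnd.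
move=> Fcvg; rewrite -(cvg_lim _ Fcvg) //; apply: lime_le.
  by apply/cvg_ex; eexists; exact: Fcvg.
apply: nearW => n /=.
have : rearr mu f t < (tau + n.+1%:R^-1)%:E.
  by rewrite Etau lte_fin ltrDl invr_gt0.
move=> /ereal_inf_lt [_ [l [l0 lf] <-]]; rewrite lte_fin => ltau.
apply: le_trans lf; apply: le_measure; rewrite ?inE //; first exact: measurable_level.
by move=> x /=; apply: lt_trans.
Qed.

(** With [a0 = f0^*(s)] and [a1 = f1^*(s)], the set where |f| exceeds [a0 + a1] is covered by two
    level sets of measure at most s, since the infima are attained, and by the null set where the
    decomposition fails. *)
Lemma rearr_add f f0 f1 (s : R) : (0 <= s)%R -> measurable_fun setT f ->
  measurable_fun setT f0 -> measurable_fun setT f1 ->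
  {ae mu, forall x, f x = (f0 x + f1 x)%R} ->
  rearr mu f (2 * s)%R <= rearr mu f0 s + rearr mu f1 s.
Proof.
move=> s0 mf mf0 mf1 [N [mN N0 NE]].
have h0 := rearr_ge0 f0 s; have h1 := rearr_ge0 f1 s.
case E0 : (rearr mu f0 s) h0 => [a0| |] // h0; last first.
  by rewrite addye ?leey // gt_eqF // (lt_le_trans _ h1) // ltNy0.
case E1 : (rearr mu f1 s) h1 => [a1| |] // h1; last by rewrite addey ?leey.
apply: ereal_inf_lbound; exists (a0 + a1)%R => //; split; first exact: addr_ge0.
have A0 := rearr_attained mf0 E0; have A1 := rearr_attained mf1 E1.
have m0 := measurable_level a0 mf0; have m1 := measurable_level a1 mf1.
set B0 := [set x | (a0 < `|f0 x|)%R] in A0 m0.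
set B1 := [set x | (a1 < `|f1 x|)%R] in A1 m1.
apply: (@le_trans _ _ (mu ((B0 `|` B1) `|` N))).
  apply: le_measure; rewrite ?inE; first exact: measurable_level.
    by apply: measurableU => //; exact: measurableU.
  move=> x /= ax; have [fx|/NE] := pselect (f x = f0 x + f1 x)%R; last by right.
  left; move: ax; rewrite fx /B0 /B1 /=.
  have [fa0|] := leP `|f0 x|%R a0; last by left.
  have [fa1|] := leP `|f1 x|%R a1; last by right.
  by rewrite ltNge (le_trans (ler_normD _ _)) // lerD.
apply: (@le_trans _ _ (mu (B0 `|` B1) + mu N)).
  by apply: measureU2 => //; exact: measurableU.
rewrite N0 adde0; apply: (@le_trans _ _ (mu B0 + mu B1)); first exact: measureU2.
by rewrite (_ : (2 * s)%:E = s%:E + s%:E) ?leeD // -EFinD mulr_natl mulr2n.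
Qed.

Lemma rearr_weight_measurable f (a : R) (k : R -> R) :
  eleb_measurable `]0%R, +oo[ (fun t => (k t)%:E) ->
  eleb_measurable `]0%R, +oo[ (fun t => (t `^ a * k t)%:E * rearr mu f t).
Proof.
move=> mk.
have -> : (fun t => (t `^ a * k t)%:E * rearr mu f t) =
    (fun t => (t `^ a)%:E * (k t)%:E * rearr mu f t).
  by apply/funext => t; rewrite EFinM.
apply: emeasurable_funM; last first.
  by apply: nonincreasing_eleb_measurable => s t _; exact: rearr_nonincreasing.
by apply: emeasurable_funM => //; exact: powR_eleb_measurable.
Qed.

End rearrangement.

(** * Constant factors that may be infinite *)

Section Lq_more.
Context {R : realType}.
Implicit Types (q : \bar R) (A B : set R) (g h : R -> \bar R).

Lemma Lq_norm_eq0 q A g : 0 < q -> (forall x, A x -> g x = 0) -> Lq_norm q A g = 0.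
Proof.
move=> q0 gA; rewrite /Lq_norm (_ : g \_ A = cst 0) ?Lnorm0 ?gt_eqF //.
apply/funext => x; rewrite /patch; case: ifPn => // xA.
by rewrite gA //; rewrite inE in xA.
Qed.

(** The factor is extended because it will be an inner norm of the small Lorentz space, which may be
    infinite. *)
Lemma Lq_norm_Zge q A (y : \bar R) g : 0 < q -> leb_measurable A ->
  eleb_measurable A g -> (forall x, A x -> 0 <= g x) -> 0 <= y ->
  y * Lq_norm q A g <= Lq_norm q A (fun u => g u * y).
Proof.
move=> q0 mA mg g0.
have N0 := Lq_norm_ge0 A g q0.
have real_case (c : R) : (0 <= c)%R ->
    c%:E * Lq_norm q A g <= Lq_norm q A (fun u => g u * c%:E).
  rewrite le_eqVlt => /predU1P[<-|c0]; first by rewrite mul0e Lq_norm_ge0.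
  rewrite -lee_pdivlMl //.
  have := @Lq_norm_Zle _ q A c^-1%R (fun u => g u * c%:E) q0.
  rewrite invr_gt0 => /(_ c0 mA) H.
  have mgc : eleb_measurable A (fun u => g u * c%:E).
    by apply: emeasurable_funM => //; exact: measurable_cst.
  apply: le_trans (H mgc).
  rewrite (_ : (fun u => _) = g) //; apply/funext => u.
  by rewrite muleCA -EFinM mulVf ?mule1 // gt_eqF.
case: y => [y|_|//]; first by rewrite lee_fin; exact: real_case.
have [->|Nneq0] := eqVneq (Lq_norm q A g) 0; first by rewrite mule0 Lq_norm_ge0.
have Npos : 0 < Lq_norm q A g by rewrite lt0e Nneq0.
rewrite gt0_mulye // leye_eq; apply/eqP/eqyP => M M0.
(* An infinite [y] dominates every natural number, and multiples of a positive norm exceed any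
   [M]. *)
have [n Hn] : exists n : nat, M%:E <= n%:R%:E * Lq_norm q A g.
  case E : (Lq_norm q A g) Npos N0 => [x| |] // x0 _; last first.
    by exists 1%N; rewrite mul1e leey.
  rewrite lte_fin in x0; exists (Num.Def.archi_bound (M / x)).
  rewrite -EFinM lee_fin -ler_pdivrMr //; apply: ltW; apply: archi_boundP.
  by rewrite divr_ge0 // ltW.
apply: le_trans Hn _; apply: le_trans (real_case n%:R%R (ler0n _ _)) _.
apply: Lq_norm_le => // x Ax; last by rewrite mule_ge0 ?g0 ?leey.
by rewrite mule_ge0 ?g0 //= lee_wpmul2l ?g0 ?leey.
Qed.

Lemma rinvE (p : R) : p != 0%R -> rinv p%:E = (p^-1)%R.
Proof. by move=> p0; rewrite /rinv inver (negbTE p0). Qed.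

End Lq_more.

(** * Weak type bounds and the K-functional *)

Section weak_estimates.
Context {d : measure_display} {T : measurableType d} {R : realType}.
Variable mu : {measure set T -> \bar R}.
Implicit Types (f g : T -> R) (q : \bar R).

Lemma rearr_weight_ge0 f (w : R) t : (0 <= w)%R -> 0 <= w%:E * rearr mu f t.
Proof. by move=> w0; rewrite mule_ge0 // rearr_ge0. Qed.

(** On [t/2, t) the rearrangement is at least [f^*(t)], and this is a piece of ratio 2. *)
Lemma rearr_le_Lq_norm (p : R) q : (0 < p)%R -> 0 < q ->
  exists2 C : R, (0 < C)%R & forall f t, (0 < t)%R ->
  (t `^ p^-1)%:E * rearr mu f t <= C%:E * Lq_norm q `]0%R, t[
     (fun u => (u `^ (rinv p%:E - rinv q))%:E * rearr mu f u).
Proof.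
move=> p0 q0; have [C C0 H] := Lq_norm_piece_ge p^-1 q0.
exists (2 `^ p^-1 * C)%R => [|f t t0]; first by rewrite mulr_gt0 // powR_gt0.
have t20 : (0 < t / 2)%R by rewrite divr_gt0.
have -> : (t `^ p^-1 = 2 `^ p^-1 * (t / 2) `^ p^-1)%R.
  by rewrite -powRM // ?(ltW t20) // mulrC divfK.
rewrite EFinM [in leRHS]EFinM -!muleA lee_pmul2l ?lte_fin ?powR_gt0 //.
apply: le_trans (H (t / 2)%R t _ (fun u => (u `^ (rinv p%:E - rinv q))%:E * rearr mu f u) t20 _ _ _) _.
- by rewrite mulrC divfK.
- exact: rearr_ge0.
- move=> u /andP[_ ut]; rewrite rinvE ?gt_eqF // lee_wpmul2l ?lee_fin ?powR_ge0 //.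
  by apply: rearr_nonincreasing; exact: ltW.
rewrite lee_pmul2l //; apply: Lq_norm_le => //.
- by move=> u /=; rewrite !in_itv /= => /andP[tu ->]; rewrite (lt_le_trans t20).
- by move=> u _; rewrite lexx rearr_weight_ge0 ?powR_ge0.
- by move=> u _; rewrite rearr_weight_ge0 ?powR_ge0.
Qed.

Lemma rearr_le_lorentz (p : R) q : (0 < p)%R -> 0 < q ->
  exists2 C : R, (0 < C)%R & forall f t, (0 < t)%R ->
  (t `^ p^-1)%:E * rearr mu f t <= C%:E * fnorm (lorentz mu p%:E q) f.
Proof.
move=> p0 q0; have [C C0 H] := rearr_le_Lq_norm p0 q0.
exists C => // f t t0; apply: le_trans (H f t t0) _.
rewrite lee_pmul2l //; apply: Lq_norm_le => //.
- by move=> u /=; rewrite !in_itv /= => /andP[->].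
- by move=> u _; rewrite mulr1 lexx rearr_weight_ge0 ?powR_ge0.
- by move=> u _; rewrite mulr1 rearr_weight_ge0 ?powR_ge0.
Qed.

Section small.
Variables (b0 : R -> R) (r0 q0 : \bar R) (p0 : R).
Hypothesis SVb : SV b0.
Hypothesis r0_gt0 : 0 < r0.
Hypothesis q0_gt0 : 0 < q0.
Hypothesis p0_gt0 : (0 < p0)%R.
Hypothesis tail1 : tail_norm r0 b0 1 < +oo.

Definition inner_norm f t := Lq_norm q0 `]0%R, t[
  (fun u => (u `^ (rinv p0%:E - rinv q0))%:E * rearr mu f u).

Lemma inner_norm_ge0 f t : 0 <= inner_norm f t.
Proof. exact: Lq_norm_ge0. Qed.

Lemma inner_norm_nondecreasing f s t : (s <= t)%R -> inner_norm f s <= inner_norm f t.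
Proof.
move=> st; apply: Lq_norm_le => //.
- by move=> u /=; rewrite !in_itv /= => /andP[->] /lt_le_trans; apply.
- by move=> u _; rewrite lexx rearr_weight_ge0 ?powR_ge0.
- by move=> u _; rewrite rearr_weight_ge0 ?powR_ge0.
Qed.

Lemma small_weight_ge0 t : (0 < t)%R -> (0 <= t `^ (- rinv r0) * b0 t)%R.
Proof. by move=> t0; rewrite mulr_ge0 ?powR_ge0 // ltW //; case: SVb => _ + _; apply. Qed.

(** For t > s the inner norm is at least its value at s. That value comes out of the outer norm over
    (s, +oo), and the tail of the weight remains. *)
Lemma rearr_le_small_lorentz : exists2 C : R, (0 < C)%R & forall f s, (0 < s)%R ->
  (s `^ p0^-1 * fine (tail_norm r0 b0 s))%:E * rearr mu f s <=
  C%:E * fnorm (small_lorentz mu p0%:E q0 r0 b0) f.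
Proof.
have [C C0 H] := rearr_le_Lq_norm p0_gt0 q0_gt0.
exists C => // f s s0.
have c0 := tail_norm_gt0 SVb r0_gt0 tail1 s0.
rewrite mulrC EFinM -muleA.
apply: (@le_trans _ _ ((fine (tail_norm r0 b0 s))%:E * (C%:E * inner_norm f s))).
  by rewrite lee_pmul2l //; exact: H.
rewrite muleCA lee_pmul2l // tail_normE // muleC.
apply: le_trans (Lq_norm_Zge _ _ _ _ _) _ => //.
- exact: leb_measurable_itv.
- apply: measurable_funS (SV_weight_measurable SVb r0); first exact: leb_measurable_itv.
  by move=> u /=; rewrite !in_itv /= !andbT; exact: lt_trans.
- move=> u /=; rewrite in_itv /= andbT => su.
  by rewrite lee_fin small_weight_ge0 // (lt_trans s0).
- exact: inner_norm_ge0.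
apply: Lq_norm_le => //.
- by move=> u /=; rewrite !in_itv /= !andbT; exact: lt_trans.
- move=> u /=; rewrite in_itv /= andbT => su.
  have u0 := small_weight_ge0 (lt_trans s0 su).
  rewrite mule_ge0 ?inner_norm_ge0 ?lee_fin //=.
  by apply: lee_wpmul2l => //; apply: inner_norm_nondecreasing; exact: ltW.
- move=> u /=; rewrite in_itv /= andbT => u0.
  by rewrite mule_ge0 ?inner_norm_ge0 ?lee_fin // small_weight_ge0.
Qed.

Lemma small_lorentz_norm_ge0 f : 0 <= fnorm (small_lorentz mu p0%:E q0 r0 b0) f.
Proof. exact: Lq_norm_ge0. Qed.

End small.

Lemma lorentz_norm_ge0 (p : \bar R) q f : 0 < q -> 0 <= fnorm (lorentz mu p q) f.
Proof. by move=> ?; exact: Lq_norm_ge0. Qed.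

Section K.
Variables X0 X1 : @fspace d T R.
Hypothesis X0_ge0 : forall f, 0 <= fnorm X0 f.
Hypothesis X1_ge0 : forall f, 0 <= fnorm X1 f.

Lemma Kfun_ge0 u f : (0 <= u)%R -> 0 <= Kfun mu X0 X1 u f.
Proof.
move=> u0; apply: le_ereal_inf_tmp => _ [f01 _ <-].
by rewrite adde_ge0 // mule_ge0.
Qed.

Lemma Kfun_nondecreasing u v f : (u <= v)%R -> Kfun mu X0 X1 u f <= Kfun mu X0 X1 v f.
Proof.
move=> uv; apply: le_ereal_inf_tmp => _ [f01 f01E <-].
apply: (@le_trans _ _ (fnorm X0 f01.1 + u%:E * fnorm X1 f01.2)).
  by apply: ereal_inf_lbound; exists f01.
by rewrite leeD2l // lee_wpmul2r // lee_fin.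
Qed.

Lemma Kfun_weight_measurable (a : R) f :
  eleb_measurable `]0%R, +oo[ (fun u => (u `^ a)%:E * Kfun mu X0 X1 u f).
Proof.
apply: emeasurable_funM; first exact: powR_eleb_measurable.
by apply: nondecreasing_eleb_measurable => s t _; exact: Kfun_nondecreasing.
Qed.

End K.

End weak_estimates.

(** * Powers as exponentials *)

Section powR_exp.
Context {R : realType}.

(** Turns inequalities between products of powers into linear ones between logarithms, within reach
    of [lra]. *)
Lemma powR_expR (x a : R) : (0 < x)%R -> (x `^ a = expR (a * ln x))%R.
Proof. by move=> x0; rewrite /powR gt_eqF. Qed.

Lemma ln_divr (x y : R) : (0 < x)%R -> (0 < y)%R -> ln (x / y) = (ln x - ln y)%R.
Proof. by move=> x0 y0; rewrite lnM ?posrE ?invr_gt0 // lnV ?posrE. Qed.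

Lemma sub_add_sub (x y z : R) : (x - y + (z - x) = z - y)%R.
Proof. by ring. Qed.

End powR_exp.

(** * Two-sided estimates of the K-functional at the balanced argument *)

Section K_estimates.
Context {d : measure_display} {T : measurableType d} {R : realType}.
Variable mu : {measure set T -> \bar R}.
Variables (theta p0 p1 p : R) (r0 r1 q0 : \bar R) (b0 : R -> R).
Hypothesis htheta : (0 < theta < 1)%R.
Hypothesis p0_gt0 : (0 < p0)%R.
Hypothesis hp01 : (p0 < p1)%R.
Hypothesis r0_gt0 : 0 < r0.
Hypothesis r1_gt0 : 0 < r1.
Hypothesis q0_gt0 : 0 < q0.
Hypothesis SVb : SV b0.
Hypothesis tail1 : tail_norm r0 b0 1 < +oo.
Hypothesis hp : (p^-1 = (1 - theta) / p0 + theta / p1)%R.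

Local Notation c t := (fine (tail_norm r0 b0 t)).
Local Notation X0 := (small_lorentz mu p0%:E q0 r0 b0).
Local Notation X1 := (lorentz mu p1%:E r1).

(* The argument u of K(u, f) that makes both terms comparable when f is cut at
   the level f^*(t). *)
Definition balance (t : R) : R := (t `^ (p0^-1 - p1^-1) * c t)%R.
Local Notation U := balance.

Let theta0 : (0 < theta)%R. Proof. by case/andP: htheta. Qed.
Let theta1 : (theta < 1)%R. Proof. by case/andP: htheta. Qed.
Let p1_gt0 : (0 < p1)%R. Proof. exact: lt_trans hp01. Qed.
Let c_gt0 t : (0 < t)%R -> (0 < c t)%R. Proof. exact: tail_norm_gt0. Qed.
Let delta_gt0 : (0 < p0^-1 - p1^-1)%R.
Proof. by rewrite subr_gt0 ltf_pV2 ?posrE. Qed.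

Lemma balance_gt0 t : (0 < t)%R -> (0 < U t)%R.
Proof. by move=> t0; rewrite mulr_gt0 ?powR_gt0 ?c_gt0. Qed.

Let kappa := ((p0^-1 - p1^-1) / 2)%R.
Let kappa_gt0 : (0 < kappa)%R. Proof. by rewrite divr_gt0. Qed.

(** The tail costs [(t/s)^kappa] with [kappa] half of the exponent of the power in [balance]; the
    other half survives as growth. *)
Lemma balance_growth : exists2 C : R, (0 < C)%R & forall s t, (0 < s)%R -> (s <= t)%R ->
  (U s <= C * (s / t) `^ ((p0^-1 - p1^-1) / 2) * U t)%R.
Proof.
have [C C0 H] := tail_norm_decay SVb r0_gt0 tail1 kappa_gt0.
exists C => // s t s0 st; have t0 := lt_le_trans s0 st.
rewrite /balance; apply: le_trans (ler_wpM2l (powR_ge0 _ _) (H _ _ s0 st)) _.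
rewrite le_eqVlt; apply/orP; left; apply/eqP.
rewrite -!mulrA mulrCA; congr (_ * _)%R; rewrite !mulrA; congr (_ * _)%R.
rewrite !powR_expR ?divr_gt0 // !ln_divr // -!expRD; congr expR.
by rewrite /kappa; set D := (p0^-1 - p1^-1)%R; field.
Qed.

Lemma ln_balance t : (0 < t)%R -> ln (U t) = ((p0^-1 - p1^-1) * ln t + ln (c t))%R.
Proof. by move=> t0; rewrite /balance lnM ?posrE ?powR_gt0 ?c_gt0 // ln_powR. Qed.

Lemma ln_balance_growth : exists2 C : R, (0 < C)%R & forall s t, (0 < s)%R -> (s <= t)%R ->
  (ln (U s) <= ln C + (p0^-1 - p1^-1) / 2 * (ln s - ln t) + ln (U t))%R.
Proof.
have [C C0 H] := balance_growth; exists C => // s t s0 st; have t0 := lt_le_trans s0 st.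
have := H s t s0 st; have := balance_gt0 t0; have := balance_gt0 s0.
move: (U s) (U t) => x y x0 y0.
have P0 : (0 < (s / t) `^ ((p0^-1 - p1^-1) / 2))%R by rewrite powR_gt0 // divr_gt0.
rewrite -ler_ln ?posrE ?mulr_gt0 //.
by rewrite lnM ?posrE ?mulr_gt0 // lnM ?posrE // ln_powR ln_divr.
Qed.

(** The identity [s^(1/p0) c(s) = U(s) s^(1/p1)] makes one weight fit both weak type bounds, the
    second with the factor U(s) that K puts before the norm of f_1. *)
Lemma K_lower : exists2 C : R, (0 < C)%R & forall f s, measurable_fun setT f ->
  (0 < s)%R ->
  (s `^ p0^-1 * c s)%:E * rearr mu f (2 * s)%R <= C%:E * Kfun mu X0 X1 (U s) f.
Proof.
have [C0 C00 H0] := rearr_le_small_lorentz mu SVb r0_gt0 q0_gt0 p0_gt0 tail1.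
have [C1 C10 H1] := rearr_le_lorentz mu p1_gt0 r1_gt0.
exists (C0 + C1)%R => [|f s mf s0]; first exact: addr_gt0.
have C01 : (0 < C0 + C1)%R by exact: addr_gt0.
rewrite -lee_pdivrMl //; apply: le_ereal_inf_tmp => _ [[f0 f1] [[mf0 _] [mf1 _] fE] <-].
rewrite lee_pdivrMl //=.
have w0 : (0 <= s `^ p0^-1 * c s)%R by rewrite mulr_ge0 ?powR_ge0 // ltW // c_gt0.
apply: le_trans (lee_wpmul2l _ (rearr_add (ltW s0) mf mf0 mf1 fE)) _.
  by rewrite lee_fin.
rewrite ge0_muleDr ?rearr_ge0 // ge0_muleDr; last 2 first.
- exact: small_lorentz_norm_ge0.
- by rewrite mule_ge0 ?lee_fin ?(ltW (balance_gt0 s0)) // lorentz_norm_ge0.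
apply: leeD.
  apply: le_trans (H0 f0 s s0) _.
  by rewrite lee_wpmul2r ?small_lorentz_norm_ge0 // lee_fin lerDl ltW.
have -> : (s `^ p0^-1 * c s = U s * s `^ p1^-1)%R.
  by rewrite /balance mulrAC -powRD ?subrK // (gt_eqF s0) implybT.
rewrite EFinM -muleA [leRHS]muleCA lee_pmul2l ?lte_fin ?balance_gt0 //.
apply: le_trans (H1 f1 s s0) _.
by rewrite lee_wpmul2r ?lorentz_norm_ge0 // lee_fin lerDr ltW.
Qed.

(* Any eta < kappa * min(theta, 1 - theta) would do; a0 and a1 are the
   exponents that remain on the left and on the right of s. *)
Let eta := (kappa * theta * (1 - theta))%R.
Let a0 := (kappa * theta * theta)%R.
Let a1 := (kappa * (1 - theta) * (1 - theta))%R.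
Let a0_gt0 : (0 < a0)%R. Proof. by rewrite !mulr_gt0. Qed.
Let theta1' : (0 < 1 - theta)%R. Proof. by rewrite subr_gt0. Qed.
Let a1_gt0 : (0 < a1)%R. Proof. by rewrite !mulr_gt0. Qed.

(** The target norm is the L_r norm of [t^(-1/r) W(t) f^*(t)]. *)
Let W v := (v `^ p^-1 * c v `^ (1 - theta))%R.
Let W_gt0 v : (0 < v)%R -> (0 < W v)%R.
Proof. by move=> v0; rewrite mulr_gt0 ?powR_gt0 ?c_gt0. Qed.

(** Since [W = U^(-theta) v^(1/p0) c], the growth of U between v and s contributes
    [(v/s)^(kappa theta)]; after the loss [(s/v)^eta] the exponent [kappa theta - eta = a0] is still
    positive. *)
Lemma envelope_left : exists2 C : R, (0 < C)%R & forall s v (B x : R), (0 < v)%R ->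
  (v <= s)%R -> (0 <= B)%R -> (W v * x <= (s / v) `^ eta * B)%R ->
  (x <= C * B * U s `^ theta * s `^ (- a0) * v `^ (a0 - p0^-1) / c v)%R.
Proof.
have [D D0 HD] := ln_balance_growth.
exists (D `^ theta)%R => [|s v B x v0 vs B0 Wx]; first by rewrite powR_gt0.
have s0 := lt_le_trans v0 vs; have cv := c_gt0 v0.
rewrite -(ler_pM2l (W_gt0 v0)); apply: le_trans Wx _.
have -> : (W v * (D `^ theta * B * U s `^ theta * s `^ (- a0) * v `^ (a0 - p0^-1) / c v) =
   W v * D `^ theta * U s `^ theta * s `^ (- a0) * v `^ (a0 - p0^-1) / c v * B)%R by ring.
rewrite ler_wpM2r //.
have := HD v s v0 vs; rewrite (ln_balance v0).
have := balance_gt0 s0; move: (U s) => Us U0.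
rewrite /W -[((c v)^-1)%R](powR_inv1 (ltW cv)).
rewrite !powR_expR ?divr_gt0 // ln_divr // -!expRD ler_expR hp.
move=> H; have := ler_wpM2l (ltW theta0) H.
rewrite /eta /a0 -/kappa; lra.
Qed.

(** Here [W = U^(1-theta) v^(1/p1)], and the exponent left over is [kappa (1-theta) - eta = a1]. *)
Lemma envelope_right : exists2 C : R, (0 < C)%R & forall s v (B x : R), (0 < s)%R ->
  (s <= v)%R -> (0 <= B)%R -> (W v * x <= (v / s) `^ eta * B)%R ->
  (x <= C * B * U s `^ (theta - 1) * s `^ a1 * v `^ (- a1 - p1^-1))%R.
Proof.
have [D D0 HD] := ln_balance_growth.
exists (D `^ (1 - theta))%R => [|s v B x s0 sv B0 Wx]; first by rewrite powR_gt0.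
have v0 := lt_le_trans s0 sv; have cv := c_gt0 v0.
rewrite -(ler_pM2l (W_gt0 v0)); apply: le_trans Wx _.
have -> : (W v * (D `^ (1 - theta) * B * U s `^ (theta - 1) * s `^ a1 * v `^ (- a1 - p1^-1)) =
   W v * D `^ (1 - theta) * U s `^ (theta - 1) * s `^ a1 * v `^ (- a1 - p1^-1) * B)%R by ring.
rewrite ler_wpM2r //.
have := HD s v s0 sv; rewrite (ln_balance v0).
have := balance_gt0 s0; move: (U s) => Us U0.
rewrite /W.
rewrite !powR_expR ?divr_gt0 // ln_divr // -!expRD ler_expR hp.
have t1 : (0 <= 1 - theta)%R by rewrite subr_ge0 ltW.
move=> H; have := ler_wpM2l t1 H.
rewrite /eta /a1 -/kappa; lra.
Qed.

(** Because [1/c] is nondecreasing, it leaves the inner norm over (0, t) with its value at t, so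
    this norm is at most a multiple of [t^a0 / c(t)]. In the outer norm the quotient [b0 / c] is
    bounded on (0, s], and past s the tail c(s) cancels [1/c(s)]. *)
Lemma small_lorentz_le : exists2 C : R, (0 < C)%R & forall g (s A : R), (0 < s)%R ->
  (0 <= A)%R ->
  (forall v, (0 < v)%R -> (v < s)%R ->
     rearr mu g v <= (A * s `^ (- a0) * v `^ (a0 - p0^-1) / c v)%:E) ->
  (forall v, (s <= v)%R -> rearr mu g v = 0) ->
  fnorm X0 g <= (C * A)%:E.
Proof.
have [C1 C10 H1] := Lq_norm_near0 q0_gt0 a0_gt0.
have [C2 C20 H2] := Lq_norm_near0 r0_gt0 a0_gt0.
have [C3 C30 H3] := Lq_norm_setU r0_gt0.
have [K K0 HK] := SV_le_tail_norm SVb r0_gt0 tail1.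
exists (C3 * (C2 * (K * C1 * 2 `^ a0) + C1))%R => [|g s A s0 A0 gl gr].
  by rewrite mulr_gt0 // addr_gt0 // !mulr_gt0 // powR_gt0.
pose A' := (A * s `^ (- a0))%R.
have A'0 : (0 <= A')%R by rewrite mulr_ge0 // powR_ge0.
have A's : (A' * s `^ a0 = A)%R.
  by rewrite /A' -mulrA powRN mulVf ?mulr1 // gt_eqF // powR_gt0.
pose G := inner_norm mu q0 p0 g.
have Gl t : (0 < t)%R -> (t <= s)%R -> G t <= (C1 * (A' / c t * t `^ a0))%:E.
  move=> t0 ts; apply: H1 => //; first by rewrite divr_ge0 // ltW // c_gt0.
  move=> u /andP[u0 ut]; rewrite rearr_weight_ge0 ?powR_ge0 //=.
  apply: le_trans (lee_wpmul2l _ (gl u u0 (lt_le_trans ut ts))) _.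
    by rewrite lee_fin powR_ge0.
  rewrite -EFinM lee_fin rinvE ?gt_eqF // -/A'.
  have -> : (u `^ (p0^-1 - rinv q0) * (A' * u `^ (a0 - p0^-1) / c u) =
      A' * (u `^ (p0^-1 - rinv q0) * u `^ (a0 - p0^-1)) / c u)%R by ring.
  rewrite -powRD ?(gt_eqF u0) ?implybT // sub_add_sub.
  rewrite mulrAC ler_wpM2r ?powR_ge0 // ler_wpM2l //.
  rewrite lef_pV2 ?posrE ?c_gt0 //.
  by apply: tail_norm_nonincreasing => //; exact: ltW.
have Gr t : (s <= t)%R -> G t <= G s.
  move=> st; apply: Lq_norm_patch_le => // u.
  have [us|su] := ltP u s; rewrite /patch.
    have ut := lt_le_trans us st.
    have -> : (u \in `]0%R, t[%classic) = (u \in `]0%R, s[%classic).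
      by apply/idP/idP; rewrite !inE /= !in_itv /= ?us ?ut.
    case: ifP => _; last by rewrite lexx.
    by rewrite lexx andbT rearr_weight_ge0 ?powR_ge0.
  have -> : (u \in `]0%R, s[%classic) = false.
    by apply/negP; rewrite inE /= in_itv /= (ltNge u) su andbF.
  by case: ifP => _; rewrite ?gr // ?mule0 lexx.
pose h t := (t `^ (- rinv r0) * b0 t)%:E * G t.
have h0 t : (0 < t)%R -> 0 <= h t.
  by move=> t0; rewrite mule_ge0 ?inner_norm_ge0 // lee_fin small_weight_ge0.
have mh : eleb_measurable `]0%R, +oo[ h.
  apply: emeasurable_funM; first exact: SV_weight_measurable.
  by apply: nondecreasing_eleb_measurable => x y _; exact: inner_norm_nondecreasing.
have E : `]0%R, +oo[%classic = `]0%R, s]%classic `|` `]s, +oo[%classic.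
  apply/seteqP; split => x /=; rewrite !in_itv /= !andbT.
    by move=> x0; case: (leP x s) => xs; [left|right]; rewrite ?x0.
  by move=> [/andP[]//|]; exact: lt_trans.
have -> : fnorm X0 g = Lq_norm r0 `]0%R, +oo[ h by [].
rewrite E; apply: le_trans (H3 _ _ _ _ _ _) _.
- exact: leb_measurable_itv.
- exact: leb_measurable_itv.
- by rewrite -E.
rewrite -mulrA EFinM lee_pmul2l // mulrDl EFinD; apply: leeD.
  (* [Lq_norm_near0] concerns an open interval, while this one contains s; enlarging it to 2s costs
     the factor [2^a0]. *)
  rewrite (@Lq_norm_restrict _ _ _ `]0%R, (2 * s)%R[); last first.
    by move=> u /=; rewrite !in_itv /= => /andP[->] us /=; lra.
  have KA : (0 <= K * C1 * A')%R by apply: mulr_ge0 => //; apply: mulr_ge0; exact: ltW.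
  have KA2 : (0 <= C1 * A')%R by apply: mulr_ge0 => //; exact: ltW.
  apply: le_trans (H2 (K * C1 * A')%R (2 * s)%R _ KA _ _) _.
  - by rewrite mulr_gt0.
  - move=> u /andP[u0 _]; rewrite /patch; case: ifPn => [|_]; last first.
      by rewrite lexx /= lee_fin; apply: mulr_ge0 => //; exact: powR_ge0.
    rewrite inE /= in_itv /= => /andP[_ us]; rewrite h0 //=.
    apply: le_trans (lee_wpmul2l _ (Gl u u0 us)) _.
      by rewrite lee_fin small_weight_ge0.
    rewrite -EFinM lee_fin.
    rewrite (_ : a0 - rinv r0 = - rinv r0 + a0)%R; last by ring.
    rewrite powRD ?(gt_eqF u0) ?implybT //.
    have -> : (u `^ (- rinv r0) * b0 u * (C1 * (A' / c u * u `^ a0)) =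
       (u `^ (- rinv r0) * u `^ a0 * (C1 * A')) * (b0 u / c u))%R by ring.
    have -> : (K * C1 * A' * (u `^ (- rinv r0) * u `^ a0) =
       (u `^ (- rinv r0) * u `^ a0 * (C1 * A')) * K)%R by ring.
    apply: ler_wpM2l.
      by apply: mulr_ge0 => //; apply: mulr_ge0; exact: powR_ge0.
    by rewrite ler_pdivrMr ?c_gt0 // HK.
  rewrite lee_fin powRM ?(ltW s0) // -A's le_eqVlt; apply/orP; left; apply/eqP; ring.
have s_ok := Gl s s0 (lexx s).
have y0 : 0 <= (C1 * (A / c s))%:E.
  by rewrite lee_fin mulr_ge0 ?divr_ge0 ?(ltW C10) ?(ltW (c_gt0 s0)).
have Gs : G s <= (C1 * (A / c s))%:E.
  by apply: le_trans s_ok _; rewrite lee_fin mulrAC A's.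
(* [Lq_norm_Zle] asks for a positive factor. *)
have [A00|Aneq0] := eqVneq A 0%R.
  rewrite Lq_norm_eq0 ?A00 ?mulr0 // => t /=; rewrite in_itv /= andbT => st.
  have G0 : G t = 0.
    apply/eqP; rewrite eq_le inner_norm_ge0 // andbT.
    apply: le_trans (Gr t (ltW st)) _; apply: le_trans Gs _.
    by rewrite A00 mul0r mulr0.
  by rewrite /h G0 mule0.
have Apos : (0 < A)%R by rewrite lt_neqAle eq_sym Aneq0.
apply: (@le_trans _ _ (Lq_norm r0 `]s, +oo[
   (fun t => (C1 * (A / c s))%:E * (t `^ (- rinv r0) * b0 t)%:E))).
  apply: Lq_norm_le => // t /=; rewrite in_itv /= andbT => st; last first.
    by rewrite mule_ge0 // lee_fin small_weight_ge0 // (lt_trans s0).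
  rewrite h0 ?(lt_trans s0) //= /h muleC lee_wpmul2r //.
    by rewrite lee_fin small_weight_ge0 // (lt_trans s0).
  exact: le_trans (Gr t (ltW st)) Gs.
apply: le_trans (Lq_norm_Zle _ _ _ _) _ => //.
- by rewrite mulr_gt0 // divr_gt0 // c_gt0.
- exact: leb_measurable_itv.
- apply: measurable_funS (SV_weight_measurable SVb r0); first exact: leb_measurable_itv.
  by move=> u /=; rewrite !in_itv /= !andbT; exact: lt_trans.
have -> : Lq_norm r0 `]s, +oo[ (fun t => (t `^ (- rinv r0) * b0 t)%:E) = (c s)%:E.
  by rewrite tail_normE.
by rewrite -EFinM lee_fin -mulrA divfK // gt_eqF // c_gt0.
Qed.

(** A hump with peak at s: a constant bound on the left leaves the slope 1/p1, and the envelope on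
    the right has slope [a1]. *)
Lemma lorentz_le : exists2 C : R, (0 < C)%R & forall g (s A : R), (0 < s)%R ->
  (0 <= A)%R ->
  (forall v, (0 < v)%R -> (v < s)%R -> rearr mu g v <= (A * s `^ (- p1^-1))%:E) ->
  (forall v, (s <= v)%R -> rearr mu g v <= (A * s `^ a1 * v `^ (- a1 - p1^-1))%:E) ->
  fnorm X1 g <= (C * A)%:E.
Proof.
have p1V : (0 < p1^-1)%R by rewrite invr_gt0.
have [C C0 H] := Lq_norm_hump r1_gt0 p1V a1_gt0.
exists C => // g s A s0 A0 gl gr; apply: (H A s) => // u us.
  rewrite mulr1 rearr_weight_ge0 ?powR_ge0 //= rinvE ?gt_eqF //.
  case/andP: us => u0 us; rewrite muleC [leRHS]EFinM.
  by apply: lee_wpmul2r; rewrite ?lee_fin ?powR_ge0 // gl.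
have u0 := lt_le_trans s0 us.
rewrite mulr1 rearr_weight_ge0 ?powR_ge0 //= rinvE ?gt_eqF //.
apply: le_trans (lee_wpmul2l _ (gr u us)) _; first by rewrite lee_fin powR_ge0.
rewrite -EFinM lee_fin mulrCA ler_wpM2l ?mulr_ge0 ?powR_ge0 //.
rewrite -powRD ?(gt_eqF u0) ?implybT //.
by rewrite sub_add_sub.
Qed.

(* With tau = f^*(s), split f into its parts above and below tau in absolute
   value: the first has f^* as rearrangement bound on (0, s) and vanishes
   beyond, the second is bounded by min(f^*, tau). *)
Lemma K_upper : exists2 C : R, (0 < C)%R & forall f (s B : R), measurable_fun setT f ->
  (0 < s)%R -> (0 <= B)%R ->
  (forall v, (0 < v)%R ->
    (W v)%:E * rearr mu f v <= (Num.max (s / v) (v / s) `^ eta * B)%:E) ->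
  (exists f01, decomposition mu X0 X1 f f01) /\
  Kfun mu X0 X1 (U s) f <= (C * U s `^ theta * B)%:E.
Proof.
have [C0 C00 H0] := small_lorentz_le.
have [C1 C10 H1] := lorentz_le.
have [D0 D00 HD0] := envelope_left.
have [D1 D10 HD1] := envelope_right.
exists (C0 * D0 + C1 * D1)%R => [|f s B mf s0 B0 fB].
  by rewrite addr_gt0 // mulr_gt0.
have U0 := balance_gt0 s0.
(* f^* is finite at every v > 0, since [W v] is positive and the assumed bound is real. *)
pose phi v := fine (rearr mu f v).
have phiE v : (0 < v)%R -> rearr mu f v = (phi v)%:E.
  move=> v0; rewrite fineK // ge0_fin_numE ?rearr_ge0 //.
  rewrite ltey; apply/eqP => fy; have := fB v v0.
  by rewrite fy gt0_muley ?lte_fin ?W_gt0 // leye_eq.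
have phi0 v : (0 < v)%R -> (0 <= phi v)%R.
  by move=> v0; rewrite -lee_fin -phiE // rearr_ge0.
have phil v : (0 < v)%R -> (v <= s)%R ->
    (phi v <= D0 * B * U s `^ theta * s `^ (- a0) * v `^ (a0 - p0^-1) / c v)%R.
  move=> v0 vs; apply: HD0 => //; have := fB v v0.
  rewrite phiE // -EFinM lee_fin max_l //.
  apply: (@le_trans _ _ 1%R); first by rewrite ler_pdivrMr // mul1r.
  by rewrite ler_pdivlMr // mul1r.
have phir v : (s <= v)%R ->
    (phi v <= D1 * B * U s `^ (theta - 1) * s `^ a1 * v `^ (- a1 - p1^-1))%R.
  move=> sv; have v0 := lt_le_trans s0 sv; apply: HD1 => //; have := fB v v0.
  rewrite phiE // -EFinM lee_fin max_r //.
  apply: (@le_trans _ _ 1%R); first by rewrite ler_pdivrMr // mul1r.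
  by rewrite ler_pdivlMr // mul1r.
pose tau := phi s.
have taus : mu [set x | (tau < `|f x|)%R] <= s%:E.
  by apply: rearr_attained => //; exact: phiE.
have mS : measurable [set x | (tau < `|f x|)%R] by exact: measurable_level.
set S := [set x | (tau < `|f x|)%R] in taus mS.
pose f0 x := (f x * \1_S x)%R.
pose f1 x := (f x * \1_(~` S) x)%R.
have mf0 : measurable_fun setT f0 by apply: measurable_funM => //; exact: measurable_indic.
have mf1 : measurable_fun setT f1.
  by apply: measurable_funM => //; apply: measurable_indic; exact: measurableC.
have f01E x : f x = (f0 x + f1 x)%R.
  rewrite /f0 /f1 -mulrDr !indicE in_setC.
  by case: (x \in S); rewrite ?addr0 ?add0r mulr1.
have f0f x : (`|f0 x| <= `|f x|)%R.
  rewrite /f0 indicE; case: (x \in S); rewrite ?mulr1 ?mulr0 ?normr0 //.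
have f1f x : (`|f1 x| <= `|f x|)%R.
  rewrite /f1 indicE; case: (x \in ~` S); rewrite ?mulr1 ?mulr0 ?normr0 //.
have f1tau x : (`|f1 x| <= tau)%R.
  rewrite /f1 indicE; case: (boolP (x \in ~` S)); rewrite ?mulr1 ?mulr0 ?normr0 ?phi0 //.
  by rewrite inE /= => /negP; rewrite -leNgt.
have n0 : fnorm X0 f0 <= (C0 * (D0 * B * U s `^ theta))%:E.
  apply: (H0 _ s) => //; first by rewrite !mulr_ge0 ?powR_ge0 // ltW.
    move=> v v0 vs; apply: le_trans (rearr_le _ _ mf0 mf f0f) _.
    by rewrite phiE // lee_fin phil // ltW.
  move=> v sv; apply: rearr_eq0; apply: (@le_trans _ _ s%:E); last by rewrite lee_fin.
  apply: le_trans taus; apply: le_measure; rewrite ?inE //; first exact: measurable_level.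
  move=> x /=; rewrite /f0 indicE; case: (boolP (x \in S)).
    by rewrite inE.
  by rewrite mulr0 normr0 ltxx.
have n1 : fnorm X1 f1 <= (C1 * (D1 * B * U s `^ (theta - 1)))%:E.
  apply: (H1 _ s) => //; first by rewrite !mulr_ge0 ?powR_ge0 // ltW.
    move=> v v0 vs; apply: (@le_trans _ _ tau%:E).
      by apply: rearr_le_cst => //; [exact: phi0|exact: ltW].
    (* At v = s the right envelope reduces to the constant bound on tau. *)
    rewrite lee_fin; apply: le_trans (phir s (lexx s)) _.
    rewrite -[leLHS]mulrA -powRD ?(gt_eqF s0) ?implybT //.
    by rewrite addrA subrr add0r.
  move=> v sv; apply: le_trans (rearr_le _ _ mf1 mf f1f) _.
  by rewrite phiE ?(lt_le_trans s0) // lee_fin phir.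
have dec : decomposition mu X0 X1 f (f0, f1).
  split => /=.
  - by split=> //; apply: le_lt_trans n0 _; rewrite ltry.
  - by split=> //; apply: le_lt_trans n1 _; rewrite ltry.
  - by apply: aeW => x; rewrite -f01E.
split; first by exists (f0, f1).
apply: (@le_trans _ _ (fnorm X0 f0 + (U s)%:E * fnorm X1 f1)).
  by apply: ereal_inf_lbound; exists (f0, f1).
apply: (@le_trans _ _ ((C0 * (D0 * B * U s `^ theta))%:E +
    (U s)%:E * (C1 * (D1 * B * U s `^ (theta - 1)))%:E)).
  by apply: leeD => //; apply: lee_wpmul2l => //; rewrite lee_fin ltW.
rewrite -EFinM -EFinD lee_fin.
(* The choice of U pays off here: [U U^(theta-1) = U^theta], the same size as the first term. *)
have -> : (U s * (C1 * (D1 * B * U s `^ (theta - 1))) =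
   C1 * D1 * B * (U s * U s `^ (theta - 1)))%R by ring.
rewrite mulr_powRB1 ?(ltW U0) //.
by rewrite le_eqVlt; apply/orP; left; apply/eqP; ring.
Qed.

End K_estimates.

(** * The geometric sampling points *)

Section geometric_scale.
Context {R : realType}.
Variable l : R.
Hypothesis l2 : (2 <= l)%R.

Definition geometric_scale (k : int) : R := (l `^ k%:~R)%R.

Let l0 : (0 < l)%R. Proof. by apply: lt_le_trans l2. Qed.
Let l1 : (1 <= l)%R. Proof. by apply: le_trans l2; rewrite ler1n. Qed.

Lemma scale_gt0 k : (0 < geometric_scale k)%R.
Proof. exact: powR_gt0. Qed.

Lemma scaleS k : (geometric_scale (k + 1) = l * geometric_scale k)%R.
Proof.
by rewrite /geometric_scale intrD powRD ?powRr1 ?(ltW l0) ?(gt_eqF l0) ?implybT // mulrC.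
Qed.

Lemma scale_doubling k : (2 * geometric_scale k <= geometric_scale (k + 1))%R.
Proof. by rewrite scaleS ler_wpM2r // ltW // scale_gt0. Qed.

Lemma scale_cover v : (0 < v)%R -> exists j, (geometric_scale j <= v < geometric_scale (j + 1))%R.
Proof.
move=> v0; have : `]0%R, +oo[%classic v by rewrite /= in_itv /= andbT.
rewrite -(doubling_cover scale_gt0 scale_doubling) => -[j _].
by rewrite /= in_itv /=; exists j.
Qed.

(** The extra factor [l^eta] is spent only for j < k, where v may lie close to the right end of its
    piece. *)
Lemma scale_distance (eta v : R) j k : (0 <= eta)%R ->
  (geometric_scale (j + 1) <= v < geometric_scale (j + 1 + 1))%R ->
  ((l `^ eta) ^+ absz (j - k)%R <= l `^ eta *
     Num.max (geometric_scale (k + 1) / v) (v / geometric_scale (k + 1)) `^ eta)%R.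
Proof.
move=> eta0 /andP[jv vj]; have v0 := lt_le_trans (scale_gt0 _) jv.
have s0 := scale_gt0 (k + 1).
have m0 : (0 < Num.max (geometric_scale (k + 1) / v) (v / geometric_scale (k + 1)))%R.
  by rewrite lt_max divr_gt0.
rewrite -powRM ?(ltW l0) ?(ltW m0) // -powR_mulrn ?powR_ge0 // -powRrM mulrC powRrM.
apply: ge0_ler_powR => //; rewrite ?nnegrE ?powR_ge0 ?mulr_ge0 ?(ltW l0) ?(ltW m0) //.
have [jk|jk] := leP k j.
  apply: (@le_trans _ _ (l * (v / geometric_scale (k + 1)))%R); last first.
    by rewrite ler_pM2l // le_max lexx orbT.
  apply: (@le_trans _ _ (v / geometric_scale (k + 1))%R); last first.
    by rewrite ler_peMl // divr_ge0 ?ltW.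
  rewrite ler_pdivlMr //; apply: le_trans jv.
  rewrite /geometric_scale -powRD ?(gt_eqF l0) ?implybT //; apply: ler_powR => //.
  by rewrite -ger0_absz ?subr_ge0 // -intrD ler_int; lia.
apply: (@le_trans _ _ (l * (geometric_scale (k + 1) / v))%R); last first.
  by rewrite ler_pM2l // le_max lexx.
rewrite mulrA ler_pdivlMr //.
apply: le_trans (ler_wpM2l (powR_ge0 _ _) (ltW vj)) _.
rewrite scaleS mulrCA ler_pM2l // /geometric_scale -powRD ?(gt_eqF l0) ?implybT //.
apply: ler_powR => //; rewrite -[_%:R]opprK -ler0_absz ?subr_le0 ?(ltW jk) //.
by rewrite -mulrNz -intrD ler_int; lia.
Qed.

End geometric_scale.

(** * Interpolation *)

Section main.
Context {d : measure_display} {T : measurableType d} {R : realType}.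
Variable mu : {measure set T -> \bar R}.
Variables (theta p0 p1 p : R) (r r0 r1 q0 : \bar R) (b0 : R -> R).
Hypothesis htheta : (0 < theta < 1)%R.
Hypothesis p0_gt0 : (0 < p0)%R.
Hypothesis hp01 : (p0 < p1)%R.
Hypothesis r_gt0 : 0 < r.
Hypothesis r0_gt0 : 0 < r0.
Hypothesis r1_gt0 : 0 < r1.
Hypothesis q0_gt0 : 0 < q0.
Hypothesis SVb : SV b0.
Hypothesis tail1 : tail_norm r0 b0 1 < +oo.
Hypothesis hp : (p^-1 = (1 - theta) / p0 + theta / p1)%R.

Local Notation c t := (fine (tail_norm r0 b0 t)).
Local Notation X0 := (small_lorentz mu p0%:E q0 r0 b0).
Local Notation X1 := (lorentz mu p1%:E r1).
Local Notation U := (balance p0 p1 r0 b0).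
Local Notation delta := (p0^-1 - p1^-1)%R.
Local Notation interp := (real_interp mu X0 X1 theta r).
Local Notation target :=
  (lorentz_karamata mu p%:E r (fun t : R => c t `^ (1 - theta))%R).

Let theta0 : (0 < theta)%R. Proof. by case/andP: htheta. Qed.
Let theta1 : (theta < 1)%R. Proof. by case/andP: htheta. Qed.
Let c_gt0 t : (0 < t)%R -> (0 < c t)%R. Proof. exact: tail_norm_gt0. Qed.
Let U0 t : (0 < t)%R -> (0 < U t)%R. Proof. exact: balance_gt0. Qed.
Let p1_gt0 : (0 < p1)%R. Proof. exact: lt_trans hp01. Qed.
Let delta0 : (0 < delta)%R. Proof. by rewrite subr_gt0 ltf_pV2 ?posrE. Qed.
Let p_gt0 : (0 < p)%R.
Proof.
by rewrite -invr_gt0 hp addr_gt0 // divr_gt0 // subr_gt0.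
Qed.

Let X0_ge0 f : 0 <= fnorm X0 f. Proof. exact: small_lorentz_norm_ge0. Qed.
Let X1_ge0 f : 0 <= fnorm X1 f. Proof. exact: lorentz_norm_ge0. Qed.

Let kf f u : \bar R := (u `^ (- theta - rinv r))%:E * Kfun mu X0 X1 u f.
Let lf f t : \bar R := (t `^ (rinv p%:E - rinv r) * c t `^ (1 - theta))%:E * rearr mu f t.

Let a_nonincreasing s t : (0 < s)%R -> (s <= t)%R ->
  (c t `^ (1 - theta) <= c s `^ (1 - theta))%R.
Proof.
move=> s0 st; have t0 := lt_le_trans s0 st.
rewrite ge0_ler_powR ?nnegrE ?subr_ge0 ?(ltW theta1) ?(ltW (c_gt0 _)) //.
exact: tail_norm_nonincreasing.
Qed.

Let lf_ge0 f t : 0 <= lf f t.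
Proof. by rewrite rearr_weight_ge0 // mulr_ge0 ?powR_ge0. Qed.

Let kf_ge0 f u : (0 <= u)%R -> 0 <= kf f u.
Proof. by move=> u0; rewrite mule_ge0 ?lee_fin ?powR_ge0 // Kfun_ge0. Qed.

Let lf_measurable f : eleb_measurable `]0%R, +oo[ (lf f).
Proof.
apply: rearr_weight_measurable; apply: nonincreasing_eleb_measurable => s t s0 st.
by rewrite lee_fin a_nonincreasing.
Qed.

Let kf_measurable f : eleb_measurable `]0%R, +oo[ (kf f).
Proof. exact: Kfun_weight_measurable. Qed.

(** The factor 2 comes from [l^kappa >= 2 D] in the growth of [balance]; the upper ratio holds
    because the tail is nonincreasing. *)
Lemma scale_exists : exists2 l : R, (2 <= l)%R & forall s, (0 < s)%R ->
  (2 * U s <= U (l * s) /\ U (l * s) <= l `^ delta * U s)%R.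
Proof.
have [D D0 HD] := @balance_growth _ p0 p1 r0 b0 p0_gt0 hp01 r0_gt0 SVb tail1.
set kappa := (delta / 2)%R in HD.
have k0 : (0 < kappa)%R by rewrite divr_gt0.
exists (Num.max 2 ((2 * D) `^ kappa^-1))%R => [|s s0]; first by rewrite le_max lexx.
set l := Num.max _ _.
have l2 : (2 <= l)%R by rewrite le_max lexx.
have l0 : (0 < l)%R by apply: lt_le_trans l2.
have lD : (2 * D <= l `^ kappa)%R.
  rewrite -[leLHS](@powRr1 _ (2 * D)%R); last by rewrite mulr_ge0 // ltW.
  rewrite -[X in (_ `^ X <= _)%R](mulVf (lt0r_neq0 k0)) powRrM.
  by rewrite ge0_ler_powR ?nnegrE ?powR_ge0 ?(ltW k0) ?(ltW l0) // le_max lexx orbT.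
have sl : (s <= l * s)%R by rewrite ler_peMl ?(ltW s0) // (le_trans _ l2) // ler1n.
have ls0 : (0 < l * s)%R by rewrite mulr_gt0.
split.
  have := HD s _ s0 sl.
  have -> : (s / (l * s) = l^-1)%R by field; rewrite !gt_eqF.
  rewrite -(powR_inv1 (ltW l0)) -powRrM mulN1r powRN => H.
  have lk0 : (0 < l `^ kappa)%R by rewrite powR_gt0.
  rewrite -(ler_pM2l D0); apply: le_trans (_ : (l `^ kappa * U s <= _)%R).
    by rewrite mulrA ler_wpM2r ?(ltW (U0 _)) // mulrC.
  by move: H; rewrite mulrAC ler_pdivlMr // mulrC.
rewrite /balance powRM ?(ltW l0) ?(ltW s0) // -mulrA ler_wpM2l ?powR_ge0 //.
by rewrite ler_wpM2l ?powR_ge0 // tail_norm_nonincreasing.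
Qed.

Lemma weight_identity s : (0 < s)%R ->
  (s `^ p^-1 * c s `^ (1 - theta) = U s `^ (- theta) * (s `^ p0^-1 * c s))%R.
Proof.
move=> s0; have := c_gt0 s0; rewrite /balance; move: (c s) => x x0.
rewrite powRM ?powR_ge0 ?(ltW x0) // -powRrM.
rewrite [RHS](_ : _ = s `^ (delta * - theta + p0^-1) * x `^ (1 - theta))%R.
  by congr (_ `^ _ * _)%R; rewrite hp; ring.
rewrite !powRD ?(gt_eqF s0) ?(gt_eqF x0) ?implybT // powRr1 ?(ltW x0) //.
by ring.
Qed.

(** One value carries each comparison: [f^*(2 s_k)] dominates f^* on the piece from [s_(k+1)], and K
    at [U(s_k)] is a lower bound for K on the piece that starts there. *)
Lemma interp_le_target : exists2 C : R, (0 < C)%R & forall f,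
  measurable_fun setT f -> fnorm target f <= C%:E * fnorm interp f.
Proof.
have [l l2 lU] := scale_exists.
have l0 : (0 < l)%R by apply: lt_le_trans l2.
have l1 : (1 < l)%R by apply: lt_le_trans l2; rewrite ltr1n.
have [C1 C10 H1] := Lq_norm_piece_le p^-1 r_gt0 l1.
have [C2 C20 H2] := Lq_norm_piece_ge (- theta) r_gt0.
have [C3 C30 H3] := @K_lower _ _ _ mu p0 p1 r0 r1 q0 b0 p0_gt0 hp01 r0_gt0 r1_gt0 q0_gt0 SVb tail1.
have C0 : (0 <= C1 * l `^ p^-1 * (C3 * C2))%R.
  by rewrite mulr_ge0 ?mulr_ge0 ?powR_ge0 // ltW.
have [C C_gt0 HC] := ell_geom r_gt0 l1 C0.
exists C => // f mf.
pose s := geometric_scale l.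
have s0 k : (0 < s k)%R by exact: scale_gt0.
have sS k : s (k + 1)%R = (l * s k)%R by exact: scaleS.
(* The target is sampled one index later, because [s_(k+1) >= 2 s_k]. *)
have -> : fnorm target f = ell r (fun k => Lq_norm r `[s (k + 1)%R, s (k + 1 + 1)%R[ (lf f)).
  have -> : fnorm target f = Lq_norm r `]0%R, +oo[ (lf f) by [].
  apply: (@Lq_norm_doubling _ (fun k => s (k + 1)%R)) => // k.
  exact: scale_doubling.
have -> : fnorm interp f = ell r (fun k => Lq_norm r `[U (s k), U (s (k + 1)%R)[ (kf f)).
  have -> : fnorm interp f = Lq_norm r `]0%R, +oo[ (kf f) by [].
  apply: (@Lq_norm_doubling _ (fun k => U (s k))) => // k; first exact: U0.
  by rewrite sS; case: (lU (s k)).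
apply: HC => [k|k|k B B0 zB]; try exact: Lq_norm_ge0.
(* Only j = k is used: this direction has no geometric loss. *)
have := zB k; rewrite subrr expr0 mul1r => {}zB.
set y := rearr mu f (2 * s k)%R.
have y0 : 0 <= y by exact: rearr_ge0.
have cy0 : 0 <= (c (s k) `^ (1 - theta))%:E * y by rewrite mule_ge0 // lee_fin powR_ge0.
have step1 : Lq_norm r `[s (k + 1)%R, s (k + 1 + 1)%R[ (lf f) <=
    (C1 * s (k + 1)%R `^ p^-1)%:E * ((c (s k) `^ (1 - theta))%:E * y).
  apply: H1 => //; first by rewrite sS.
  move=> u /andP[su _]; rewrite lf_ge0 /= /lf rinvE ?gt_eqF // EFinM -muleA.
  have sku : (s k <= u)%R.
    by apply: le_trans su; rewrite sS ler_peMl ?(ltW (s0 _)) // ltW.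
  apply: lee_wpmul2l; first by rewrite lee_fin powR_ge0.
  apply: lee_pmul => //; rewrite ?lee_fin ?powR_ge0 ?rearr_ge0 ?a_nonincreasing //.
  apply: rearr_nonincreasing; apply: le_trans su; rewrite sS.
  by rewrite ler_wpM2r // ltW.
have step2 : (U (s k) `^ (- theta))%:E * Kfun mu X0 X1 (U (s k)) f <= (C2 * B)%:E.
  apply: (@le_trans _ _ (C2%:E * Lq_norm r `[U (s k), U (s (k + 1)%R)[ (kf f))).
    apply: H2; [exact: U0|by rewrite sS; case: (lU (s k))| |].
      by apply: Kfun_ge0 => //; exact: ltW (U0 _).
    move=> u /andP[Uu _]; apply: lee_wpmul2l; first by rewrite lee_fin powR_ge0.
    exact: Kfun_nondecreasing.
  by rewrite EFinM lee_pmul2l.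
have step3 : (s k `^ p^-1 * c (s k) `^ (1 - theta))%:E * y <= (C3 * (C2 * B))%:E.
  rewrite weight_identity // EFinM -muleA.
  apply: le_trans (lee_wpmul2l _ (H3 f (s k) mf (s0 k))) _.
    by rewrite lee_fin powR_ge0.
  by rewrite muleCA EFinM lee_pmul2l.
apply: le_trans step1 _.
rewrite sS powRM ?(ltW l0) ?(ltW (s0 _)) // mulrA EFinM -muleA.
apply: (@le_trans _ _ ((C1 * l `^ p^-1)%:E * (C3 * (C2 * B))%:E)).
  apply: lee_wpmul2l; first by rewrite lee_fin mulr_ge0 ?powR_ge0 // ltW.
  by rewrite muleA -EFinM.
by rewrite -EFinM lee_fin !mulrA.
Qed.

(** A geometric bound on the pieces of the target norm, centred at k, becomes the pointwise
    hypothesis of [K_upper] at [s_(k+1)]; [ell_geom] then sums over k. *)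
Lemma target_le_interp : exists2 C : R, (0 < C)%R & forall f,
  fcarrier target f -> (exists f01, decomposition mu X0 X1 f f01) /\
    fnorm interp f <= C%:E * fnorm target f.
Proof.
have [l l2 lU] := scale_exists.
have l0 : (0 < l)%R by apply: lt_le_trans l2.
have l1 : (1 < l)%R by apply: lt_le_trans l2; rewrite ltr1n.
(* The exponent of [K_upper], so that [l^eta] is the ratio in [ell_geom]; [L] below bounds the ratio
   of consecutive values of U. *)
pose eta := (delta / 2 * theta * (1 - theta))%R.
have eta0 : (0 < eta)%R by rewrite !mulr_gt0 ?subr_gt0 // ltf_pV2 ?posrE.
pose L := (l `^ delta)%R.
have L1 : (1 < L)%R.
  by have := @gt0_ltr_powR _ delta delta0 1%R l; rewrite powR1; apply=> //; rewrite nnegrE ltW.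
have w1 : (1 < l `^ eta)%R.
  by have := @gt0_ltr_powR _ eta eta0 1%R l; rewrite powR1; apply=> //; rewrite nnegrE ltW.
have [C1 C10 H1] := Lq_norm_piece_le (- theta) r_gt0 L1.
have [C2 C20 H2] := Lq_norm_piece_ge p^-1 r_gt0.
have [C3 C30 H3] := @K_upper _ _ _ mu theta p0 p1 p r0 r1 q0 b0 htheta p0_gt0 hp01
  r0_gt0 r1_gt0 q0_gt0 SVb tail1 hp.
(* [l * l] because v lies below [s_(j+2)], [C2] from the lower bound on piece j, [l^eta] from
   [scale_distance]. *)
pose E := ((l * l) `^ p^-1 * C2 * l `^ eta)%R.
have E0 : (0 < E)%R by rewrite !mulr_gt0 ?powR_gt0 // mulr_gt0.
have C0 : (0 <= C1 * (C3 * L `^ theta * E))%R.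
  apply: mulr_ge0; first exact: ltW.
  apply: mulr_ge0; last exact: ltW.
  by apply: mulr_ge0; [exact: ltW|exact: powR_ge0].
have [C C_gt0 HC] := ell_geom r_gt0 w1 C0.
exists C => // f [mf f_fin].
pose s := geometric_scale l.
have s0 k : (0 < s k)%R by exact: scale_gt0.
have sS k : s (k + 1)%R = (l * s k)%R by exact: scaleS.
pose z k := Lq_norm r `[s k, s (k + 1)%R[ (lf f).
have Kbound k (B : R) : (0 <= B)%R ->
    (forall j, z j <= ((l `^ eta) ^+ absz (j - k)%R * B)%:E) ->
    (exists f01, decomposition mu X0 X1 f f01) /\
    Kfun mu X0 X1 (U (s (k + 1)%R)) f <= (C3 * U (s (k + 1)%R) `^ theta * (E * B))%:E.
  move=> B0 zB; apply: H3 => //; first by rewrite mulr_ge0 // ltW.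
  move=> v v0; have [j' jv] := scale_cover l2 v0.
  (* As f^* is nonincreasing, the norm over a piece controls it only to the right, so the piece
     before the one containing v is used. *)
  pose j := (j' - 1)%R; have j'E : j' = (j + 1)%R by rewrite /j subrK.
  rewrite j'E in jv; have [jv1 jv2] := andP jv.
  set y := (c v `^ (1 - theta))%:E * rearr mu f v.
  have y0 : 0 <= y by rewrite mule_ge0 ?rearr_ge0 // lee_fin powR_ge0.
  have piece : (s j `^ p^-1)%:E * y <= C2%:E * z j.
    apply: H2 => //; first exact: scale_doubling.
    move=> u /andP[ju uj]; have u0 := lt_le_trans (s0 j) ju.
    have uv : (u <= v)%R by apply: le_trans jv1; exact: ltW.
    rewrite /lf rinvE ?gt_eqF // EFinM -muleA; apply: lee_wpmul2l.
      by rewrite lee_fin powR_ge0.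
    apply: lee_pmul => //; rewrite ?lee_fin ?powR_ge0 ?rearr_ge0 ?a_nonincreasing //.
    exact: rearr_nonincreasing.
  have vll : (v `^ p^-1 <= (l * l) `^ p^-1 * s j `^ p^-1)%R.
    rewrite -powRM ?mulr_ge0 ?(ltW l0) ?(ltW (s0 _)) //.
    rewrite ge0_ler_powR ?nnegrE ?invr_ge0 ?mulr_ge0 ?(ltW l0) ?(ltW (s0 _)) ?(ltW p_gt0) ?(ltW v0) //.
    by rewrite -mulrA -!sS ltW.
  rewrite EFinM -muleA -/y.
  apply: (@le_trans _ _ (((l * l) `^ p^-1 * s j `^ p^-1)%:E * y)).
    by apply: lee_wpmul2r.
  rewrite EFinM -muleA.
  apply: (@le_trans _ _ (((l * l) `^ p^-1)%:E * (C2%:E * ((l `^ eta) ^+ absz (j - k)%R * B)%:E))).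
    apply: lee_wpmul2l; first by rewrite lee_fin powR_ge0.
    by apply: le_trans piece _; rewrite lee_pmul2l.
  rewrite -!EFinM lee_fin.
  have := scale_distance l2 k (ltW eta0) jv.
  set M := (Num.max _ _ `^ eta)%R => HM.
  have -> : (M * (E * B) = (l * l) `^ p^-1 * (C2 * (l `^ eta * M * B)))%R.
    by rewrite /E; ring.
  apply: ler_wpM2l; first exact: powR_ge0.
  rewrite ler_pM2l //; exact: ler_wpM2r.
have f_fin' : Lq_norm r `]0%R, +oo[ (lf f) < +oo by exact: f_fin.
split.
  have : Lq_norm r `]0%R, +oo[ (lf f) \is a fin_num by rewrite ge0_fin_numE // Lq_norm_ge0.
  case EN : (Lq_norm r `]0%R, +oo[ (lf f)) => [N| |] // _.
  have N0 : (0 <= N)%R by rewrite -lee_fin -EN Lq_norm_ge0.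
  (* The full target norm bounds every piece, so it serves as B; this yields the decomposition that
     puts f into the sum space. *)
  case: (Kbound 0%R N N0) => // j.
  apply: (@le_trans _ _ N%:E).
    rewrite -EN; apply: Lq_norm_le => //.
    - by move=> u /=; rewrite !in_itv /= andbT => /andP[/(lt_le_trans (s0 j))].
    - by move=> u _; rewrite lexx lf_ge0.
  by rewrite lee_fin ler_peMl // exprn_ege1 // ltW.
have -> : fnorm target f = ell r z.
  have -> : fnorm target f = Lq_norm r `]0%R, +oo[ (lf f) by [].
  by apply: Lq_norm_doubling => // k; exact: scale_doubling.
have -> : fnorm interp f = ell r (fun k => Lq_norm r `[U (s k), U (s (k + 1)%R)[ (kf f)).
  have -> : fnorm interp f = Lq_norm r `]0%R, +oo[ (kf f) by [].
  apply: (@Lq_norm_doubling _ (fun k => U (s k))) => // k; first exact: U0.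
  by rewrite sS; case: (lU (s k)).
apply: HC => [k|k|k B B0 zB]; try exact: Lq_norm_ge0.
have [_ KB] := Kbound k B B0 zB.
have [U2 UL] := lU (s k) (s0 k); rewrite -sS in U2 UL.
have K0 : 0 <= Kfun mu X0 X1 (U (s (k + 1)%R)) f.
  by apply: Kfun_ge0 => //; exact: ltW (U0 _).
apply: (@le_trans _ _ ((C1 * U (s k) `^ (- theta))%:E * Kfun mu X0 X1 (U (s (k + 1)%R)) f)).
  apply: H1 => //; first exact: U0.
  move=> u /andP[Uu uU]; rewrite kf_ge0 ?(le_trans _ Uu) ?(ltW (U0 _)) //=.
  apply: lee_wpmul2l; first by rewrite lee_fin powR_ge0.
  by apply: Kfun_nondecreasing => //; exact: ltW.
apply: le_trans (lee_wpmul2l _ KB) _.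
  by rewrite lee_fin mulr_ge0 ?powR_ge0 // ltW.
rewrite -EFinM lee_fin.
have := U0 (s0 (k + 1)%R); have := U0 (s0 k).
move: (U (s k)) (U (s (k + 1)%R)) UL => x y yLx x0 y0.
have xy : (x `^ (- theta) * y `^ theta <= L `^ theta)%R.
  rewrite powRN ler_pdivrMl ?powR_gt0 // mulrC -powRM ?powR_ge0 ?(ltW x0) //.
  by rewrite ge0_ler_powR ?nnegrE ?mulr_ge0 ?powR_ge0 ?(ltW theta0) ?(ltW x0) ?(ltW y0).
have lhsE a b a' b' e g : (a * b * (a' * b' * (e * g)) = a * a' * (e * g) * (b * b') :> R)%R.
  by ring.
have rhsE a a' b e g : (a * (a' * b * e) * g = a * a' * (e * g) * b :> R)%R by ring.
rewrite lhsE rhsE; apply: ler_wpM2l => //.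
by apply: mulr_ge0; apply: mulr_ge0 => //; exact: ltW.
Qed.

End main.

Local Close Scope ereal_scope.

Theorem corollary37 (d : measure_display) (T : measurableType d) (R : realType)
  (mu : {measure set T -> \bar R})
  (mu_sigma_finite : sigma_finite setT mu) (mu_nonatomic : nonatomic mu)
  (theta p0 p1 p : R) (r r0 r1 q0 : \bar R) (b0 : R -> R)
  (htheta : 0 < theta < 1)
  (hp0 : 1 < p0) (hp01 : p0 < p1)
  (hr : (0 < r)%E) (hr0 : (0 < r0)%E) (hr1 : (0 < r1)%E) (hq0 : (0 < q0)%E)
  (hb0 : SV b0)
  (hfin : (tail_norm r0 b0 1 < +oo)%E)
  (hp : 1 / p = (1 - theta) / p0 + theta / p1) :
  cong_spaces
    (real_interp mu (small_lorentz mu p0%:E q0 r0 b0) (lorentz mu p1%:E r1)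
       theta r)
    (lorentz_karamata mu p%:E r
       (fun t : R => fine (tail_norm r0 b0 t) `^ (1 - theta))).
Proof.
have p0_gt0 : 0 < p0 by apply: lt_trans hp0.
rewrite div1r in hp.
have [C1 C10 H1] := @interp_le_target _ _ _ mu _ _ _ _ _ _ r1 q0 _ htheta p0_gt0 hp01
  hr hr0 hr1 hq0 hb0 hfin hp.
have [C2 C20 H2] := @target_le_interp _ _ _ mu _ _ _ _ _ _ r1 q0 _ htheta p0_gt0 hp01
  hr hr0 hr1 hq0 hb0 hfin hp.
split; split.
- move=> f [mf _ ffin]; split=> //; apply: le_lt_trans (H1 f mf) _.
  by rewrite lte_mul_pinfty // lee_fin ltW.
- by exists C1 => // f [mf _ _]; exact: H1.
- move=> f fX; have [fdec fle] := H2 f fX; case: fX => mf ffin; split=> //.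
  by apply: le_lt_trans fle _; rewrite lte_mul_pinfty // lee_fin ltW.
- by exists C2 => // f /H2[].
Qed.
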